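(* Let $(R,\mathfrak m)$ be a Gorenstein local ring with infinite residue field and let $\mathfrak a$ be a licci $\mathfrak m$-primary ideal linked to a complete intersection in $n$ steps. Let $\mathfrak a=\mathfrak a_0\sim\mathfrak a_1\sim\cdots\sim\mathfrak a_n$ be a sequence of links such that $\mathfrak a_n$ is a complete intersection and, for every $0\le i\le n-1$, the ideals $\mathfrak a_i$ and $\mathfrak a_{i+1}$ are linked with respect to a minimal reduction of $\mathfrak a_i$. Then \[ \ell(R/\mathfrak a)=\sum_{i=0}^{n}(-1)^i\,\mathrm e(\mathfrak a_i). \]
   Context: All rings are Noetherian; $\ell$ denotes length. For an $\mathfrak m$-primary ideal $\mathfrak b$ of a Noetherian local ring $(R,\mathfrak m)$ of dimension $d$, $\mathrm e(\mathfrak b)$ is the Hilbert-Samuel multiplicity, i.e. the coefficient of $n^d/d!$ in the polynomial that equals $\ell(R/\mathfrak b^n)$ for $n\gg 0$. A complete intersection ideal is an ideal generated by a regular sequence. In a Cohen-Macaulay local ring $R$, two proper ideals $\mathfrak a$ and $\mathfrak a_1$ are linked with respect to a complete intersection ideal $\mathfrak c$, written $\mathfrak a\sim\mathfrak a_1$, if $\mathfrak a_1=\mathfrak c:\mathfrak a$ and $\mathfrak a=\mathfrak c:\mathfrak a_1$. An ideal $\mathfrak a$ is licci (in the linkage class of a complete intersection) if there are ideals $\mathfrak a_1,\dots,\mathfrak a_n$ with $\mathfrak a\sim\mathfrak a_1\sim\cdots\sim\mathfrak a_n$ and $\mathfrak a_n$ a complete intersection; then $\mathfrak a$ is linked to a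 complete intersection in $n$ steps. A reduction of an ideal $\mathfrak a$ is a subideal $\mathfrak b\subset\mathfrak a$ with $\mathfrak a^{k+1}=\mathfrak b\mathfrak a^k$ for some $k\ge 0$; a minimal reduction is a reduction that is minimal with respect to inclusion. *)

(* Defs.v *)
(* MathComp algebra, with ideals of a commutative ring represented as subsets
   [set R] from the classical-sets layer of MathComp-Analysis. *)
From HB Require Import structures.
From mathcomp Require Import all_boot all_order all_algebra.
From mathcomp Require Import boolp classical_sets cardinality.

Set Implicit Arguments.
Unset Strict Implicit.
Unset Printing Implicit Defensive.

Import GRing.Theory.
Local Open Scope ring_scope.
Local Open Scope classical_set_scope.

Section Ideals.
Variable R : comNzRingType.
Implicit Types (I J : set R) (s : seq R).

(* The unit ideal is allowed, unlike in MathComp's [idealr_closed]. *)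
Definition is_ideal I : Prop :=
  [/\ I 0, forall x y, I x -> I y -> I (x + y)
         & forall r x, I x -> I (r * x)].

Definition proper_ideal I : Prop := is_ideal I /\ ~ I 1.

Definition ideal_gen (A : set R) : set R := smallest is_ideal A.

Definition ideal_mul I J : set R :=
  ideal_gen [set z | exists x y, [/\ I x, J y & z = x * y]].

Definition ideal_exp I (n : nat) : set R := iter n (ideal_mul I) setT.

Definition colon I J : set R := [set r | forall x, J x -> I (r * x)].

Definition radical I : set R := [set x | exists n : nat, I (x ^+ n)].

Definition prime_ideal I : Prop :=
  proper_ideal I /\ forall x y, I (x * y) -> I x \/ I y.

Definition primary_ideal I : Prop :=
  proper_ideal I /\ forall x y, I (x * y) -> I x \/ exists n : nat, I (y ^+ n).

Definition maximal_ideal I : Prop :=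
  proper_ideal I /\ forall J, proper_ideal J -> I `<=` J -> J = I.

Definition noetherian : Prop :=
  forall I, is_ideal I -> exists s, I = ideal_gen [set` s].

Definition local_ring (m : set R) : Prop :=
  maximal_ideal m /\ forall J, maximal_ideal J -> J = m.

(* The residue field R / m, as its set of cosets x + m. *)
Definition residue_field (m : set R) : set (set R) :=
  [set C | exists x, C = [set y | m (y - x)]].

Definition m_primary (m I : set R) : Prop := primary_ideal I /\ radical I = m.

Definition chain (P : set R -> Prop) (F : nat -> set R) (l : nat) : Prop :=
  (forall i, (i <= l)%N -> P (F i)) /\
  (forall i, (i < l)%N -> F i `<` F i.+1).

(* Default value 0 when the lengths of the chains are unbounded. *)
Definition max_length (L : set nat) : nat :=
  xget 0%N [set l | L l /\ forall k, L k -> (k <= l)%N].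

Definition krull_dim : nat :=
  max_length [set l | exists F, chain prime_ideal F l].

(* The length of the R-module R / I: submodules of R / I are identified with
   the ideals of R that contain I. *)
Definition colength I : nat :=
  max_length
    [set l | exists F, chain (fun J => is_ideal J /\ I `<=` J) F l].

Definition is_hilbert_samuel_poly I (p : {poly rat}) : Prop :=
  exists N : nat, forall n : nat, (N <= n)%N ->
    (colength (ideal_exp I n))%:R = p.[n%:R].

Definition hilbert_samuel_poly I : {poly rat} :=
  xget 0 [set p | is_hilbert_samuel_poly I p].

Definition multiplicity I : rat :=
  (krull_dim`!)%:R * (hilbert_samuel_poly I)`_krull_dim.

Definition regular_sequence s : Prop :=
  (forall i r, (i < size s)%N ->
     ideal_gen [set` take i s] (s`_i * r) -> ideal_gen [set` take i s] r)
  /\ ~ ideal_gen [set` s] 1.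

Definition complete_intersection I : Prop :=
  exists s, regular_sequence s /\ I = ideal_gen [set` s].

Definition linked (c a b : set R) : Prop :=
  [/\ complete_intersection c, proper_ideal a, proper_ideal b,
      b = colon c a & a = colon c b].

Definition linked_to_ci_in_steps (n : nat) (a : set R) : Prop :=
  exists b : nat -> set R,
    [/\ b 0%N = a,
        forall i, (i < n)%N -> exists c, linked c (b i) (b i.+1)
      & complete_intersection (b n)].

Definition reduction (b a : set R) : Prop :=
  [/\ is_ideal b, b `<=` a
    & exists k : nat, ideal_exp a k.+1 = ideal_mul b (ideal_exp a k)].

Definition minimal_reduction (b a : set R) : Prop :=
  reduction b a /\ forall b', reduction b' a -> b' `<=` b -> b' = b.

End Ideals.

Section Gorenstein.
Variable R : comNzRingType.

Definition injective_module (Q : lmodType R) : Prop :=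
  forall (M N : lmodType R) (f : {linear M -> N}) (g : {linear M -> Q}),
    injective f -> exists h : {linear N -> Q}, forall x, h (f x) = g x.

(* A bounded injective resolution 0 -> M -> E 0 -> E 1 -> ... with E i = 0
   for i > n. *)
Definition finite_injective_dimension (M : lmodType R) : Prop :=
  exists (n : nat) (E : nat -> lmodType R) (e : {linear M -> E 0%N})
         (d : forall i, {linear E i -> E i.+1}),
    [/\ forall i, injective_module (E i),
        injective e,
        forall x, d 0%N x = 0 <-> exists y, e y = x,
        forall i x, d i.+1 x = 0 <-> exists y, d i y = x
      & forall i, (n < i)%N -> forall x : E i, x = 0].

(* A Noetherian local ring is Gorenstein when it has finite injective
   dimension as a module over itself. *)
Definition gorenstein_local (m : set R) : Prop :=
  [/\ noetherian R, local_ring m & finite_injective_dimension R^o].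

End Gorenstein.

(* Main.v *)
Require Import Defs.
From HB Require Import structures.
From mathcomp Require Import all_boot all_order all_algebra.
From mathcomp Require Import boolp classical_sets cardinality.
From mathcomp Require Import ring zify.

Set Implicit Arguments.
Unset Strict Implicit.
Unset Printing Implicit Defensive.

Import GRing.Theory.
Local Open Scope ring_scope.
Local Open Scope classical_set_scope.

(** The statement follows from two facts about one link [a ~ b] with respect
    to a complete intersection [c] that is a reduction of [a].

    - [l (R/a) + l (R/b) = l (R/c)] ([colength_linked]). Here [b = c : a], and
      the sum [l (R/K) + l (R/(c : K))] does not grow when [K] grows, because
      [(c : K) / (c : K')] has length at most one when [K' / K] is simple: it
      embeds in the socle of [R/c], which is simple since [R] is Gorenstein.
      The sum has the value [l (R/c)] at [K = c] and at [K = R].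

    - [e (a) = l (R/c)] ([multiplicity_reduction]). The lengths of [R/a^n] and
      [R/c^n] differ by terms of lower order, and
      [l (R/c^(n+1)) = C (n+r, r) l (R/c)] when [c] is generated by a regular
      sequence of length [r], which is also the dimension of [R].

    Hence [e (a_i) = l (R/a_i) + l (R/a_(i+1))] for [i < n], while
    [e (a_n) = l (R/a_n)] as [a_n] is a reduction of itself; the alternating
    sum telescopes.

    Lengths are lengths of chains in intervals of ideals. They are additive by
    the modular law, and subquotients are compared by monotone maps between
    intervals, so that no quotient module is ever formed. A regular sequence is
    treated one element at a time: [regular_ideal k b] says that [b] is
    generated by one of length [k].

    Simplicity of the socle ([socle_simple]). For an injective resolution [E]
    of [R], the modules [{e in E i | I e = 0}] compute [Ext^i (R/I, R)].
    Adding the elements of a regular sequence to the zero ideal shows that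
    [Ext^r (R/c, R)] is a copy of [R/c] and that the higher groups vanish.
    Boundedness of [E] then gives [Ext^i (R/J, R) = 0] for [i > r] and all [J]
    containing [c]. For a nonzero [y] in the socle of [R/c] the sequence
    [0 -> R/m -> R/c -> R/(c+(y)) -> 0] therefore makes the multiplication
    [y : Ext^r (R/c, R) -> Ext^r (R/m, R)] surjective, so the image of
    [Ext^r (R/m, R)] in [R/c] is [y (R/c)] for every such [y].

    Powers of [c] ([regular_on_graded_add], [rlen_graded]). For [c = b + (y)]
    the graded piece [c^(n+1) / c^(n+2)] is filtered by [y c^n]. The induction
    is on statements about [b^n / (b^(n+1) + q b^n)] with [q] arbitrary, where
    [q] collects the elements of the sequence that have been split off.

    Existence of Hilbert polynomials and the Artin-Rees lemma both come from
    the ascending chain condition on graded families [B n] of ideals contained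
    in [c^n], that is, on homogeneous ideals of the Rees algebra
    ([rees_noetherian]). It is proved by induction on the generators of [c],
    comparing a family with its leading coefficients with respect to one
    generator, as for Hilbert's basis theorem.

    Dimension ([krull_dim_regular]). A chain of primes of length [r] is built
    downwards from a prime containing [c]. Conversely, a chain of [l] primes starting at
    [P] forces [l (R/(P + c^n))] to grow at least like [n^l], while it is at
    most [l (R/c^n)], which is of order [n^r]. *)

(** * Ideals as subsets *)

Section IdealOperations.
Variable R : comNzRingType.
Implicit Types (I J K : set R) (x y z : R) (s : seq R).

Definition ideal_add I J : set R :=
  [set z | exists x y, [/\ I x, J y & z = x + y]].

Definition ideal_scale y K : set R := [set z | exists2 k, K k & z = y * k].

Definition principal y : set R := ideal_scale y setT.

Definition colon_elt I y : set R := [set r | I (y * r)].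

Lemma ideal0 I : is_ideal I -> I 0. Proof. by case. Qed.

Lemma idealD I x y : is_ideal I -> I x -> I y -> I (x + y).
Proof. by case=> _ h _; exact: h. Qed.

Lemma idealMl I r x : is_ideal I -> I x -> I (r * x).
Proof. by case=> _ _ h; exact: h. Qed.

Lemma idealMr I r x : is_ideal I -> I x -> I (x * r).
Proof. by move=> hI Ix; rewrite mulrC; exact: idealMl. Qed.

Lemma idealN I x : is_ideal I -> I x -> I (- x).
Proof. by move=> hI Ix; rewrite -mulN1r; exact: idealMl. Qed.

Lemma idealB I x y : is_ideal I -> I x -> I y -> I (x - y).
Proof. by move=> hI Ix Iy; apply: idealD => //; exact: idealN. Qed.

Lemma ideal_addl_cancel I x y : is_ideal I -> I x -> I (x + y) -> I y.
Proof. by move=> hI Ix Ixy; rewrite -(addKr x y) addrC; exact: idealB. Qed.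

Lemma ideal_eqT I : is_ideal I -> I 1 -> I = setT.
Proof.
move=> hI I1; apply/seteqP; split => // x _.
by rewrite -(mulr1 x); exact: idealMl.
Qed.

Lemma is_idealT : is_ideal (@setT R). Proof. by split. Qed.

Lemma is_ideal_zero : is_ideal [set (0 : R)].
Proof.
by split=> [//|x y -> ->|r x ->] /=; rewrite ?addr0 ?mulr0.
Qed.

Lemma is_ideal_add I J : is_ideal I -> is_ideal J -> is_ideal (ideal_add I J).
Proof.
move=> hI hJ; split.
- by exists 0, 0; split; [exact: ideal0|exact: ideal0|rewrite addr0].
- move=> _ _ [x1 [y1 [Ix1 Jy1 ->]]] [x2 [y2 [Ix2 Jy2 ->]]].
  exists (x1 + x2), (y1 + y2); split; [exact: idealD|exact: idealD|].
  by rewrite addrACA.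
- move=> r _ [x [y [Ix Jy ->]]]; exists (r * x), (r * y).
  by split; [exact: idealMl|exact: idealMl|rewrite mulrDr].
Qed.

Lemma is_ideal_scale y K : is_ideal K -> is_ideal (ideal_scale y K).
Proof.
move=> hK; split.
- by exists 0; [exact: ideal0|rewrite mulr0].
- move=> _ _ [k1 K1 ->] [k2 K2 ->]; exists (k1 + k2); first exact: idealD.
  by rewrite mulrDr.
- move=> r _ [k Kk ->]; exists (r * k); first exact: idealMl.
  by rewrite mulrCA.
Qed.

Lemma is_ideal_principal y : is_ideal (principal y).
Proof. exact/is_ideal_scale/is_idealT. Qed.

Lemma is_ideal_cap I J : is_ideal I -> is_ideal J -> is_ideal (I `&` J).
Proof.
move=> hI hJ; split.
- by split; exact: ideal0.
- by move=> x y [Ix Jx] [Iy Jy]; split; exact: idealD.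
- by move=> r x [Ix Jx]; split; exact: idealMl.
Qed.

Lemma is_ideal_colon_elt I y : is_ideal I -> is_ideal (colon_elt I y).
Proof.
move=> hI; split; rewrite /colon_elt /=.
- by rewrite mulr0; exact: ideal0.
- by move=> u v Iu Iv; rewrite mulrDr; exact: idealD.
- by move=> r u Iu; rewrite mulrCA; exact: idealMl.
Qed.

Lemma is_ideal_colon I J : is_ideal I -> is_ideal (colon I J).
Proof.
move=> hI; split.
- by move=> x _; rewrite mul0r; exact: ideal0.
- by move=> u v Iu Iv x Jx; rewrite mulrDl; apply: idealD => //; [exact: Iu|exact: Iv].
- by move=> r u Iu x Jx; rewrite -mulrA; apply: idealMl => //; exact: Iu.
Qed.

Lemma is_ideal_gen (A : set R) : is_ideal (ideal_gen A).
Proof.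
split.
- by move=> I [hI _]; exact: ideal0.
- by move=> x y hx hy I hIA; apply: idealD (hx I hIA) (hy I hIA); case: hIA.
- by move=> r x hx I hIA; apply: idealMl (hx I hIA); case: hIA.
Qed.

Lemma gen_sub (A : set R) I : is_ideal I -> A `<=` I -> ideal_gen A `<=` I.
Proof. by move=> hI hA; exact: smallest_sub. Qed.

Lemma sub_gen (A : set R) : A `<=` ideal_gen A.
Proof. exact: sub_gen_smallest. Qed.

Lemma ideal_add_subl I J : is_ideal J -> I `<=` ideal_add I J.
Proof.
by move=> hJ x Ix; exists x, 0; split => //; [exact: ideal0|rewrite addr0].
Qed.

Lemma ideal_add_subr I J : is_ideal I -> J `<=` ideal_add I J.
Proof.
by move=> hI x Jx; exists 0, x; split => //; [exact: ideal0|rewrite add0r].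
Qed.

Lemma ideal_add_lub I J K :
  is_ideal K -> I `<=` K -> J `<=` K -> ideal_add I J `<=` K.
Proof.
move=> hK hI hJ _ [x [y [Ix Jy ->]]]; apply: idealD => //; [exact: hI|exact: hJ].
Qed.

Lemma ideal_add_mono I J I' J' :
  I `<=` I' -> J `<=` J' -> ideal_add I J `<=` ideal_add I' J'.
Proof.
by move=> hI hJ _ [x [y [Ix Jy ->]]]; exists x, y; split => //; [exact: hI|exact: hJ].
Qed.

Lemma ideal_addK I J : is_ideal J -> is_ideal I -> J `<=` I -> ideal_add I J = I.
Proof.
move=> hJ hI JI; apply/seteqP; split; first exact: ideal_add_lub.
exact: ideal_add_subl.
Qed.

Lemma principal_id y : principal y y.
Proof. by exists 1 => //; rewrite mulr1. Qed.

Lemma mem_principal r y : principal y (y * r). Proof. by exists r. Qed.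

Lemma principal_sub y I : is_ideal I -> I y -> principal y `<=` I.
Proof. by move=> hI Iy _ [r _ ->]; exact: idealMr. Qed.

Lemma ideal_add_principal_gen I y : is_ideal I -> ideal_add I (principal y) y.
Proof. by move=> hI; apply: ideal_add_subr => //; exact: principal_id. Qed.

Lemma gen_nil : ideal_gen [set` [::]] = [set (0 : R)].
Proof.
apply/seteqP; split.
  by apply: gen_sub; [exact: is_ideal_zero|move=> x /=; rewrite in_nil].
by move=> _ ->; exact: (ideal0 (is_ideal_gen _)).
Qed.

Lemma gen_rcons s y :
  ideal_gen [set` rcons s y] = ideal_add (ideal_gen [set` s]) (principal y).
Proof.
have hs := is_ideal_gen [set` s]; have hy := is_ideal_principal y.
apply/seteqP; split.
- apply: gen_sub; first exact: is_ideal_add.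
  move=> x /=; rewrite mem_rcons inE => /orP[/eqP->|xs].
    exact: ideal_add_principal_gen.
  by apply: ideal_add_subl => //; exact: sub_gen.
- apply: ideal_add_lub; first exact: is_ideal_gen.
  + apply: gen_sub; first exact: is_ideal_gen.
    by move=> x /= xs; apply: sub_gen; rewrite /= mem_rcons inE xs orbT.
  + apply: principal_sub; first exact: is_ideal_gen.
    by apply: sub_gen; rewrite /= mem_rcons inE eqxx.
Qed.

Lemma is_ideal_mul I J : is_ideal (ideal_mul I J).
Proof. exact: is_ideal_gen. Qed.

Lemma mem_mul I J x y : I x -> J y -> ideal_mul I J (x * y).
Proof. by move=> Ix Jy; apply: sub_gen; exists x, y. Qed.

Lemma ideal_mul_sub I J K : is_ideal K ->
  (forall x y, I x -> J y -> K (x * y)) -> ideal_mul I J `<=` K.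
Proof.
by move=> hK h; apply: gen_sub => // _ [x [y [Ix Jy ->]]]; exact: h.
Qed.

Lemma ideal_mul_mono I J I' J' :
  I `<=` I' -> J `<=` J' -> ideal_mul I J `<=` ideal_mul I' J'.
Proof.
move=> hI hJ; apply: ideal_mul_sub; first exact: is_ideal_mul.
by move=> x y Ix Jy; apply: mem_mul; [exact: hI|exact: hJ].
Qed.

Lemma ideal_mul_subr I J : is_ideal J -> ideal_mul I J `<=` J.
Proof. by move=> hJ; apply: ideal_mul_sub => // x y _; exact: idealMl. Qed.

Lemma ideal_mul_subl I J : is_ideal I -> ideal_mul I J `<=` I.
Proof. by move=> hI; apply: ideal_mul_sub => // x y Ix _; exact: idealMr. Qed.

Lemma ideal_mul1 I : is_ideal I -> ideal_mul I setT = I.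
Proof.
move=> hI; apply/seteqP; split; first exact: ideal_mul_subl.
by move=> x Ix; rewrite -(mulr1 x); exact: mem_mul.
Qed.

Lemma ideal_mulA_sub I J K :
  ideal_mul (ideal_mul I J) K `<=` ideal_mul I (ideal_mul J K).
Proof.
have h := is_ideal_mul I (ideal_mul J K).
apply: ideal_mul_sub => // x z IJx Kz.
suff /(_ x IJx) : ideal_mul I J `<=` colon_elt (ideal_mul I (ideal_mul J K)) z.
  by rewrite /colon_elt /= mulrC.
apply: ideal_mul_sub; first exact: is_ideal_colon_elt.
move=> u v Iu Jv; rewrite /colon_elt /= mulrCA (mulrC z).
by apply: mem_mul => //; exact: mem_mul.
Qed.

Lemma ideal_mulC I J : ideal_mul I J = ideal_mul J I.
Proof.
by apply/seteqP; split; apply: ideal_mul_sub;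
  try exact: is_ideal_mul; move=> x y hx hy; rewrite mulrC; exact: mem_mul.
Qed.

Lemma ideal_expS I n : ideal_exp I n.+1 = ideal_mul I (ideal_exp I n).
Proof. by []. Qed.

Lemma is_ideal_exp I n : is_ideal (ideal_exp I n).
Proof. by case: n => [|n]; [exact: is_idealT|exact: is_ideal_mul]. Qed.

Lemma ideal_exp1 I : is_ideal I -> ideal_exp I 1 = I.
Proof. exact: ideal_mul1. Qed.

Lemma ideal_expS_sub I n : ideal_exp I n.+1 `<=` ideal_exp I n.
Proof. by apply: ideal_mul_subr; exact: is_ideal_exp. Qed.

Lemma ideal_exp_le I n k : (n <= k)%N -> ideal_exp I k `<=` ideal_exp I n.
Proof.
move=> /subnK <-; elim: (k - n)%N => [//|i IH].
by rewrite addSn; apply: subset_trans IH; exact: ideal_expS_sub.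
Qed.

Lemma ideal_exp_mono I J n : I `<=` J -> ideal_exp I n `<=` ideal_exp J n.
Proof. by move=> IJ; elim: n => [//|n IH]; exact: ideal_mul_mono. Qed.

Lemma ideal_exp_zero n : ideal_exp [set (0 : R)] n.+1 = [set 0].
Proof.
apply/seteqP; split.
  apply: ideal_mul_sub; first exact: is_ideal_zero.
  by move=> x y -> _; rewrite /= mul0r.
by move=> _ ->; exact: (ideal0 (is_ideal_exp _ _)).
Qed.

(** In degree [n + 1], a monomial in the generators of [b] and in [y] either is
    a monomial in those of [b] alone or is divisible by [y]. All inductions on
    the number of generators rest on this decomposition. *)
Lemma ideal_exp_add_principal b y n : is_ideal b ->
  ideal_exp (ideal_add b (principal y)) n.+1 =
  ideal_add (ideal_exp b n.+1)
            (ideal_scale y (ideal_exp (ideal_add b (principal y)) n)).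
Proof.
move=> hb; set c := ideal_add b (principal y).
have hc : is_ideal c by apply: is_ideal_add => //; exact: is_ideal_principal.
have cy : c y by exact: ideal_add_principal_gen.
have bc : b `<=` c by apply: ideal_add_subl; exact: is_ideal_principal.
have hs k : is_ideal (ideal_add (ideal_exp b k) (ideal_scale y (ideal_exp c n))).
  by apply: is_ideal_add; [exact: is_ideal_exp|exact/is_ideal_scale/is_ideal_exp].
apply/seteqP; split; last first.
  apply: ideal_add_lub; first exact: is_ideal_exp.
    exact: ideal_exp_mono.
  by move=> _ [k ck ->]; exact: mem_mul.
elim: n hs => [|n IH] hs.
  rewrite !ideal_exp1 //; apply: ideal_add_mono => //.
apply: ideal_mul_sub => // _ w [b0 [_ [bb0 [r _ ->] ->]]] cw.
rewrite mulrDl -mulrA.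
have yP : ideal_add (ideal_exp b n.+2) (ideal_scale y (ideal_exp c n.+1)) (y * (r * w)).
  apply: ideal_add_subr; first exact: is_ideal_exp.
  by exists (r * w) => //; exact: (idealMl _ (is_ideal_exp c n.+1) cw).
suff : ideal_add (ideal_exp b n.+2) (ideal_scale y (ideal_exp c n.+1)) (b0 * w).
  by move=> h; exact: (idealD (hs _) h yP).
have [|u [_ [bu [v cv ->] ->]]] := IH _ w cw.
  by move=> k; apply: is_ideal_add; [exact: is_ideal_exp|exact/is_ideal_scale/is_ideal_exp].
exists (b0 * u), (y * (b0 * v)); split; first exact: mem_mul.
  by exists (b0 * v) => //; apply: mem_mul => //; exact: bc.
by rewrite mulrDr mulrCA.
Qed.

End IdealOperations.

(** * Lengths of intervals of ideals *)

Section Chains.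
Variable R : comNzRingType.
Implicit Types (P Q : set R -> Prop) (F G : nat -> set R).

Lemma chain_const P F : P (F 0%N) -> chain P F 0.
Proof. by move=> hP; split => // i; rewrite leqn0 => /eqP ->. Qed.

Lemma chain_map P Q F l (phi : set R -> set R) :
  chain P F l -> (forall A, P A -> Q (phi A)) ->
  (forall A B, P A -> P B -> A `<=` B -> phi A `<=` phi B) ->
  (forall A B, P A -> P B -> A `<=` B -> phi B `<=` phi A -> B `<=` A) ->
  chain Q (phi \o F) l.
Proof.
move=> [hP hF] hQ hmono hstr; split=> i hi; first exact/hQ/hP.
have Pi := hP i (ltnW hi); have Pi1 := hP i.+1 hi.
have [h1 h2] := hF i hi; split; first exact: hmono.
by move=> h; apply: h2; exact: hstr h.
Qed.

Lemma chain_rcons P F l A :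
  chain P F l -> P A -> F l `<` A ->
  chain P (fun i => if (i <= l)%N then F i else A) l.+1.
Proof.
move=> [hP hF] PA FA; split=> i hi.
  by case: ifP => h //; exact: hP.
move: (hi); rewrite ltnS => -> /=.
move: hi; rewrite ltnS leq_eqVlt => /orP[/eqP ->|hi]; first by rewrite ltnn.
by rewrite hi; exact: hF.
Qed.

Lemma chain_cat P F G p q :
  chain P F p -> chain P G q -> F p `<=` G 0%N ->
  chain P (fun i => if (i <= p)%N then F i else G (i - p)%N) (p + q).
Proof.
move=> [hP hF] [hP' hG] FG; split=> i hi.
  by case: ifP => h; [exact: hP|apply: hP'; lia].
case: (ltngtP i p) => h.
- by exact: hF.
- by rewrite subSn; [apply: hG; lia|lia].
- rewrite h subSnn; have [h1 h2] := hG 0%N ltac:(lia).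
  by split; [exact: subset_trans h1|move=> h3; apply: h2; exact: subset_trans FG].
Qed.

End Chains.

Section Lengths.
Variable R : comNzRingType.
Implicit Types (I J K L A B : set R) (x y z : R).

Lemma max_lengthP (S : set nat) b :
  S !=set0 -> (forall l, S l -> (l <= b)%N) ->
  S (max_length S) /\ forall l, S l -> (l <= max_length S)%N.
Proof.
move=> [l0 S0] hb.
suff hex : exists l, S l /\ forall k, S k -> (k <= l)%N.
  by rewrite /max_length; exact: (xgetPex 0%N hex).
have ex : exists l, `[< S l >] by exists l0; exact/asboolP.
have ub l : `[< S l >] -> (l <= b)%N by move=> /asboolP; exact: hb.
case: (ex_maxnP ex ub) => l /asboolP Sl hl; exists l; split => // k Sk.
by apply: hl; exact/asboolP.
Qed.

Definition interval I K J : Prop := [/\ is_ideal J, I `<=` J & J `<=` K].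

(** The length of the module [K / I]. *)
Definition rlen I K : nat :=
  max_length [set l | exists F, chain (interval I K) F l].

Definition finlen I K : Prop :=
  exists b, forall F l, chain (interval I K) F l -> (l <= b)%N.

Lemma colength_rlen I : colength I = rlen I setT.
Proof.
rewrite /colength /rlen; congr max_length.
by apply/seteqP; split=> l [F [h1 h2]]; exists F; split => // i hi;
  [have [] := h1 i hi|have [] := h1 i hi].
Qed.

Lemma rlen_max I K F l :
  finlen I K -> chain (interval I K) F l -> (l <= rlen I K)%N.
Proof.
move=> [b hb] hF.
have [||_ h] := @max_lengthP [set l | exists F, chain (interval I K) F l] b.
- by exists l, F.
- by move=> k [G hG]; exact: hb hG.
- by apply: h; exists F.
Qed.

Lemma rlen_attained I K :
  is_ideal I -> I `<=` K -> finlen I K ->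
  exists F, chain (interval I K) F (rlen I K).
Proof.
move=> hI hIK [b hb].
have [||h _] := @max_lengthP [set l | exists F, chain (interval I K) F l] b.
- by exists 0%N, (fun=> I); apply: chain_const; split.
- by move=> k [G hG]; exact: hb hG.
- exact: h.
Qed.

Lemma rlen_le_bound I K b : is_ideal I -> I `<=` K ->
  (forall F l, chain (interval I K) F l -> (l <= b)%N) -> (rlen I K <= b)%N.
Proof.
move=> hI hIK hb; have [|F hF] := rlen_attained hI hIK; first by exists b.
exact: hb hF.
Qed.

(** Lengths are compared along strictly monotone maps of intervals, which
    replaces the isomorphism theorems for subquotients. *)
Lemma rlen_embed I K I' K' (phi : set R -> set R) :
  is_ideal I -> I `<=` K ->
  (forall A, interval I K A -> interval I' K' (phi A)) ->
  (forall A B, interval I K A -> interval I K B -> A `<=` B -> phi A `<=` phi B) ->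
  (forall A B, interval I K A -> interval I K B -> A `<=` B ->
     phi B `<=` phi A -> B `<=` A) ->
  finlen I' K' -> finlen I K /\ (rlen I K <= rlen I' K')%N.
Proof.
move=> hI hIK h1 h2 h3 hf.
have hb F l : chain (interval I K) F l -> (l <= rlen I' K')%N.
  by move=> hF; exact: (rlen_max hf (chain_map hF h1 h2 h3)).
by split; [exists (rlen I' K')|exact: rlen_le_bound].
Qed.

Lemma rlen_sub I K I' K' :
  is_ideal I -> I `<=` K -> I' `<=` I -> K `<=` K' -> finlen I' K' ->
  finlen I K /\ (rlen I K <= rlen I' K')%N.
Proof.
move=> hI hIK hI' hK' hf; apply: (rlen_embed (phi := id)) => //.
by move=> A [hA IA AK]; split => //; [exact: subset_trans IA|exact: subset_trans hK'].
Qed.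

Lemma rlen_lt_r I A B :
  is_ideal I -> I `<=` A -> is_ideal A -> is_ideal B -> A `<` B -> finlen I B ->
  (rlen I A < rlen I B)%N.
Proof.
move=> hI IA hA hB AB hf.
have IB : I `<=` B by apply: subset_trans IA _; case: AB.
have AB' : A `<=` B by case: AB.
have [fA _] := rlen_sub hI IA (@subset_refl _ I) AB' hf.
have [F [hF1 hF2]] := rlen_attained hI IA fA.
apply: (rlen_max (F := fun i => if (i <= rlen I A)%N then F i else B) hf).
apply: chain_rcons.
- split=> // i hi; have [h1 h2 h3] := hF1 i hi.
  by split => //; exact: subset_trans AB'.
- by split.
- have [_ _ h3] := hF1 _ (leqnn _); split; first exact: subset_trans AB'.
  by case: AB => _ AB hB'; apply: AB; exact: subset_trans h3.
Qed.

Lemma rlen_le_r I A B :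
  is_ideal I -> I `<=` A -> is_ideal A -> is_ideal B -> A `<=` B -> finlen I B ->
  (rlen I A <= rlen I B)%N.
Proof. by move=> hI IA hA hB AB hf; have [] := rlen_sub hI IA (@subset_refl _ I) AB hf. Qed.

(** Each step of a chain from [I] to [L] is strict in [_ `&` K] or in
    [_ + K], by the modular law; the two resulting chains bound its length. *)
Lemma rlen_add I K L :
  is_ideal I -> is_ideal K -> is_ideal L -> I `<=` K -> K `<=` L ->
  finlen I K -> finlen K L ->
  finlen I L /\ rlen I L = (rlen I K + rlen K L)%N.
Proof.
move=> hI hK hL IK KL fIK fKL.
have IL := subset_trans IK KL.
have hb F l : chain (interval I L) F l -> (l <= rlen I K + rlen K L)%N.
  move=> hF; have [hF1 hF2] := hF.
  (* The value of [phi] increases at each step and is at most the bound. *)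
  pose phi i := (rlen I (F i `&` K) + rlen K (ideal_add (F i) K))%N.
  have hcap i : (i <= l)%N -> is_ideal (F i `&` K) /\ I `<=` F i `&` K.
    move=> hi; have [h1 h2 h3] := hF1 i hi; split; first exact: is_ideal_cap.
    by move=> x Ix; split; [exact: h2|exact: IK].
  have hsum i : (i <= l)%N ->
      is_ideal (ideal_add (F i) K) /\ ideal_add (F i) K `<=` L.
    move=> hi; have [h1 h2 h3] := hF1 i hi; split; first exact: is_ideal_add.
    exact: ideal_add_lub.
  have ksum i : (i <= l)%N -> K `<=` ideal_add (F i) K.
    by move=> hi; have [h1 _ _] := hF1 i hi; exact: ideal_add_subr.
  have fcap i : (i <= l)%N -> finlen I (F i `&` K).
    move=> hi; have [h1 h2] := hcap i hi.
    by have [] := rlen_sub hI h2 (@subset_refl _ I) (@subIsetr _ _ _) fIK.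
  have fsum i : (i <= l)%N -> finlen K (ideal_add (F i) K).
    move=> hi; have [h1 h2] := hsum i hi.
    by have [] := rlen_sub hK (ksum i hi) (@subset_refl _ K) h2 fKL.
  have step i : (i < l)%N -> (phi i < phi i.+1)%N.
    move=> hi; have [s1 s2] := hF2 i hi; have hi' := ltnW hi.
    have [c1 c2] := hcap i hi'; have [c1' c2'] := hcap i.+1 hi.
    have [d1 d2] := hsum i hi'; have [d1' d2'] := hsum i.+1 hi.
    have [e1 _ _] := hF1 i hi'; have [e1' _ _] := hF1 i.+1 hi.
    have sc : F i `&` K `<=` F i.+1 `&` K by exact: setSI.
    have sd : ideal_add (F i) K `<=` ideal_add (F i.+1) K by exact: ideal_add_mono.
    have lc := rlen_le_r hI c2 c1 c1' sc (fcap _ hi).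
    have ld := rlen_le_r hK (ksum _ hi') d1 d1' sd (fsum _ hi).
    have [h|h] := pselect (F i.+1 `&` K `<=` F i `&` K); last first.
      rewrite /phi -addSn; apply: leq_add => //.
      by apply: rlen_lt_r (fcap _ hi).
    rewrite /phi -addnS; apply: leq_add => //.
    apply: rlen_lt_r (fsum _ hi) => //; first exact: ksum.
    split => // h'; apply: s2 => z Fz.
    have [//|u [v [Fu Kv zuv]]] := h' z; first exact: ideal_add_subl.
    rewrite zuv; apply: idealD => //.
    suff /h[] : (F i.+1 `&` K) v by [].
    split => //; have -> : v = z - u by rewrite zuv addrAC subrr add0r.
    by apply: idealB => //; exact: s1.
  have hphi i : (i <= l)%N -> (i <= phi i)%N.
    elim: i => [//|i IH hi]; apply: leq_ltn_trans (step i hi).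
    exact/IH/ltnW.
  apply: leq_trans (hphi l (leqnn l)) _; apply: leq_add.
    have [h1 h2] := hcap l (leqnn l).
    by apply: rlen_le_r => //; exact: subIsetr.
  have [h1 h2] := hsum l (leqnn l).
  by apply: rlen_le_r => //; exact: ksum.
have fIL : finlen I L by exists (rlen I K + rlen K L)%N.
split => //; apply/eqP; rewrite eqn_leq; apply/andP; split.
  exact: rlen_le_bound.
have [F [hF1 hF2]] := rlen_attained hI IK fIK.
have [G [hG1 hG2]] := rlen_attained hK KL fKL.
have cF : chain (interval I L) F (rlen I K).
  by split => // i hi; have [? ? h] := hF1 i hi; split => //; exact: subset_trans KL.
have cG : chain (interval I L) G (rlen K L).
  by split => // i hi; have [? h ?] := hG1 i hi; split => //; exact: subset_trans h.
apply: (rlen_max fIL (chain_cat cF cG _)).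
have [_ _ h] := hF1 _ (leqnn _); have [_ h' _] := hG1 0%N (leq0n _).
exact: subset_trans h'.
Qed.

Lemma rlen_refl I : is_ideal I -> rlen I I = 0%N.
Proof.
move=> hI; apply/eqP; rewrite -leqn0; apply: rlen_le_bound => // F l [h1 h2].
case: l h1 h2 => [//|l] h1 h2; have [_ h] := h2 0%N isT.
have [_ h3 _] := h1 0%N isT; have [_ _ h4] := h1 1%N isT.
by case: h; exact: subset_trans h3.
Qed.

Lemma finlen_refl I : is_ideal I -> finlen I I.
Proof.
move=> hI; exists 0%N => F l [h1 h2].
case: l h1 h2 => [//|l] h1 h2; have [_ h] := h2 0%N isT.
have [_ h3 _] := h1 0%N isT; have [_ _ h4] := h1 1%N isT.
by case: h; exact: subset_trans h3.
Qed.

(** Multiplication by [y] identifies [K / (K `&` (I : y))] with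
    [(I + y K) / I]. *)
Lemma rlen_scale I K y :
  is_ideal I -> is_ideal K ->
  (finlen I (ideal_add I (ideal_scale y K)) <-> finlen (K `&` colon_elt I y) K)
  /\ (finlen (K `&` colon_elt I y) K ->
      rlen I (ideal_add I (ideal_scale y K)) = rlen (K `&` colon_elt I y) K).
Proof.
move=> hI hK; set M := ideal_add I _; set C := K `&` _.
have hyK := is_ideal_scale y hK.
have hM : is_ideal M by exact: is_ideal_add.
have hC : is_ideal C by apply: is_ideal_cap => //; exact: is_ideal_colon_elt.
have IM : I `<=` M by exact: ideal_add_subl.
have CK : C `<=` K by exact: subIsetl.
have E1 : finlen C K -> finlen I M /\ (rlen I M <= rlen C K)%N.
  apply: (rlen_embed (phi := fun A => K `&` colon_elt A y)) => //.
  - move=> A [hA IA AM]; split.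
    + by apply: is_ideal_cap => //; exact: is_ideal_colon_elt.
    + by move=> x [Kx Ix]; split => //; exact: IA.
    + exact: subIsetl.
  - by move=> A B _ _ AB x [Kx Ax]; split => //; exact: AB.
  - move=> A B [hA IA AM] [hB IB BM] AB h z Bz.
    have [u [_ [Iu [k Kk ->] zuk]]] := BM z Bz.
    rewrite zuk; apply: idealD => //; first exact: IA.
    suff /h[] : (K `&` colon_elt B y) k by [].
    split => //; apply: (ideal_addl_cancel hB (IB _ Iu)).
    by rewrite -zuk.
have E2 : finlen I M -> finlen C K /\ (rlen C K <= rlen I M)%N.
  apply: (rlen_embed (phi := fun A => ideal_add I (ideal_scale y A))) => //.
  - move=> A [hA CA AK]; split.
    + by apply: is_ideal_add => //; exact: is_ideal_scale.
    + by apply: ideal_add_subl; exact: is_ideal_scale.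
    + by apply: ideal_add_mono => // _ [k Ak ->]; exists k => //; exact: AK.
  - by move=> A B _ _ AB; apply: ideal_add_mono => // _ [k Ak ->]; exists k => //; exact: AB.
  - move=> A B [hA CA AK] [hB CB BK] AB h b Bb.
    have [|u [_ [Iu [a Aa ->] yb]]] := h (y * b).
      by apply: ideal_add_subr => //; exists b.
    rewrite -(subrK a b); apply: idealD => //; apply: CA; split.
      by apply: idealB => //; [exact: BK|exact: AK].
    by rewrite /colon_elt /= mulrBr yb addrK.
split; first by split=> [/E2[]|/E1[]].
move=> f; have [f' le1] := E1 f; have [_ le2] := E2 f'.
by apply/eqP; rewrite eqn_leq le1.
Qed.

Lemma rlen_second I K :
  is_ideal I -> is_ideal K ->
  (finlen I (ideal_add I K) <-> finlen (K `&` I) K)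
  /\ (finlen (K `&` I) K -> rlen I (ideal_add I K) = rlen (K `&` I) K).
Proof.
move=> hI hK; have := @rlen_scale I K 1 hI hK.
have -> : ideal_scale 1 K = K.
  by apply/seteqP; split=> [_ [k Kk ->]|k Kk]; [rewrite mul1r|exists k => //; rewrite mul1r].
have -> // : colon_elt I 1 = I.
by apply/seteqP; split=> x; rewrite /colon_elt /= mul1r.
Qed.

Definition finite_colength I : Prop := finlen I setT.

Lemma colength_lt I J : is_ideal I -> is_ideal J -> I `<` J ->
  finite_colength I -> (colength J < colength I)%N.
Proof.
move=> hI hJ [IJ JI]; rewrite !colength_rlen => f.
have [fJ _] := rlen_sub hJ (@subsetT _ J) IJ (@subset_refl _ _) f.
have [fIJ _] := rlen_sub hI IJ (@subset_refl _ _) (@subsetT _ J) f.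
have [_ ->] := rlen_add hI hJ (@is_idealT R) IJ (@subsetT _ J) fIJ fJ.
rewrite -[X in (X < _)%N]add0n ltn_add2r.
by rewrite -(rlen_refl hI); apply: rlen_lt_r.
Qed.

Lemma colength_le I J : is_ideal J -> I `<=` J -> finite_colength I ->
  finite_colength J /\ (colength J <= colength I)%N.
Proof.
move=> hJ IJ; rewrite !colength_rlen => f.
exact: (rlen_sub hJ (@subsetT _ J) IJ (@subset_refl _ _) f).
Qed.

Lemma colengthT : colength (@setT R) = 0%N.
Proof. by rewrite colength_rlen rlen_refl //; exact: is_idealT. Qed.

Lemma finite_colengthT : finite_colength (@setT R).
Proof. exact/finlen_refl/is_idealT. Qed.

(** Additivity along [0 -> R/(I:y) -> R/I -> R/(I+(y)) -> 0]. *)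
Lemma colength_colon I y : is_ideal I ->
  finite_colength (colon_elt I y) -> finite_colength (ideal_add I (principal y)) ->
  finite_colength I /\
  colength I = (colength (colon_elt I y) + colength (ideal_add I (principal y)))%N.
Proof.
move=> hI f1 f2; rewrite !colength_rlen.
have [E1 E2] := rlen_scale y hI (@is_idealT R).
move: E1 E2; rewrite setTI => E1 E2.
have hJ := is_ideal_add hI (is_ideal_principal y).
have [f ->] := rlen_add hI hJ (@is_idealT R) (ideal_add_subl (is_ideal_principal y))
  (@subsetT _ _) (proj2 E1 f1) f2.
by split => //; rewrite E2.
Qed.

End Lengths.

(** * Noetherian local rings *)

Section Noetherian.
Variable R : comNzRingType.
Hypothesis noethR : noetherian R.
Implicit Types (I J K : set R) (x y z : R).

Lemma ideal_chain_le (F : nat -> set R) i j :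
  (forall k, F k `<=` F k.+1) -> (i <= j)%N -> F i `<=` F j.
Proof.
move=> hF /subnK <-; elim: (j - i)%N => [//|k IH].
by rewrite addSn; exact: subset_trans IH (hF _).
Qed.

Lemma ideal_acc (F : nat -> set R) :
  (forall k, is_ideal (F k)) -> (forall k, F k `<=` F k.+1) ->
  exists k0, forall k, (k0 <= k)%N -> F k = F k0.
Proof.
move=> hF hinc; pose U := [set x | exists k, F k x].
have hU : is_ideal U.
  split; first by exists 0%N; exact: ideal0.
  - move=> x y [i Fx] [j Fy]; exists (maxn i j); apply: idealD => //.
      exact: (ideal_chain_le hinc (leq_maxl i j)).
    exact: (ideal_chain_le hinc (leq_maxr i j)).
  - by move=> r x [i Fx]; exists i; exact: idealMl.
have [s Us] := noethR hU.
have hs : forall x, x \in s -> U x by move=> x xs; rewrite Us; exact: sub_gen.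
have [k0 hk0] : exists k0, forall x, x \in s -> F k0 x.
  elim: s hs {Us} => [|x s IH] hs; first by exists 0%N.
  have [|k0 hk0] := IH; first by move=> z zs; apply: hs; rewrite inE zs orbT.
  have [k1 hk1] := hs x (mem_head _ _).
  exists (maxn k0 k1) => z; rewrite inE => /orP[/eqP ->|zs].
    exact: (ideal_chain_le hinc (leq_maxr _ _)).
  by apply: (ideal_chain_le hinc (leq_maxl _ _)); exact: hk0.
exists k0 => k hk; apply/seteqP; split; last exact: ideal_chain_le.
apply: (@subset_trans _ U); first by move=> x; exists k.
by rewrite Us; apply: gen_sub => // x xs; exact: hk0.
Qed.

Lemma noetherian_ind (P : set R -> Prop) :
  (forall I, is_ideal I -> (forall J, is_ideal J -> I `<` J -> P J) -> P I) ->
  forall I, is_ideal I -> P I.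
Proof.
move=> hP I hI; apply: contrapT => nPI.
pose B := {J : set R | is_ideal J /\ ~ P J}.
have next (J : B) : exists J' : B, proj1_sig J `<` proj1_sig J'.
  case: J => J [hJ nPJ] /=; apply: contrapT => h; apply: nPJ; apply: hP => // J' hJ' JJ'.
  by apply: contrapT => nPJ'; apply: h; exists (exist _ J' (conj hJ' nPJ')).
have [f hf] := choice next.
pose F k := iter k f (exist _ I (conj hI nPI) : B).
have [|k|k0 hk0] := @ideal_acc (fun k => proj1_sig (F k)).
- by move=> k; case: (F k) => J [].
- by case: (hf (F k)).
- by have [_] := hf (F k0); apply; rewrite -[f _]/(F k0.+1) (hk0 k0.+1).
Qed.

(** Induction on the number of generators. *)
Lemma ideal_fg_ind (P : set R -> Prop) :
  P [set 0] ->
  (forall b y, is_ideal b -> P b -> P (ideal_add b (principal y))) ->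
  forall I, is_ideal I -> P I.
Proof.
move=> h0 hS I hI; have [s ->] := noethR hI.
elim/last_ind: s => [|s y IH]; first by rewrite gen_nil.
by rewrite gen_rcons; apply: hS => //; exact: is_ideal_gen.
Qed.

(** An ideal maximal among those disjoint from a multiplicative set is prime. *)
Lemma prime_avoiding (S : set R) :
  S 1 -> (forall x y, S x -> S y -> S (x * y)) ->
  forall I, is_ideal I -> (forall x, I x -> ~ S x) ->
  exists Q, [/\ prime_ideal Q, I `<=` Q & forall x, Q x -> ~ S x].
Proof.
move=> S1 SM; apply: noetherian_ind => I hI IH dis.
have [[J [hJ IJ dJ]]|h] := pselect (exists J, [/\ is_ideal J, I `<` J & forall x, J x -> ~ S x]).
  have [Q [pQ JQ dQ]] := IH J hJ IJ dJ; exists Q; split => //.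
  by apply: subset_trans JQ; case: IJ.
exists I; split => //; split; first by split => // /dis.
have meet x : ~ I x -> exists s, S s /\ ideal_add I (principal x) s.
  move=> nIx; apply: contrapT => h'; apply: h; exists (ideal_add I (principal x)); split.
  - by apply: is_ideal_add => //; exact: is_ideal_principal.
  - split; first by apply: ideal_add_subl; exact: is_ideal_principal.
    by move=> /(_ x (ideal_add_principal_gen _ hI)).
  - by move=> s As Ss; apply: h'; exists s.
move=> x y Ixy; apply: contrapT => /not_orP[/meet [s [Ss]] + /meet [t [St]]].
move=> [i [_ [Ii [r _ ->] es]]] [j [_ [Ij [r' _ ->] et]]].
apply: (dis (s * t)); last exact: SM.
rewrite es et mulrDl !mulrDr.
have h1 := idealMl i hI Ij; have h2 := idealMr (y * r') hI Ii.
have h3 := idealMl (x * r) hI Ij.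
have h4 : I (x * r * (y * r')) by rewrite mulrACA; exact: idealMr.
exact: idealD hI (idealD hI h1 h2) (idealD hI h3 h4).
Qed.

End Noetherian.

Section Local.
Variables (R : comNzRingType) (m : set R).
Hypothesis noethR : noetherian R.
Hypothesis localR : local_ring m.
Implicit Types (I J K : set R) (x y z : R).

(** The ideals that contain a power of [m]; unlike for [m]-primary ideals,
    the unit ideal is one of them. *)
Definition open_ideal I : Prop :=
  is_ideal I /\ forall x, m x -> exists k, I (x ^+ k).

Lemma maximal_is_ideal : is_ideal m.
Proof. by case: localR => [[[]]]. Qed.

Lemma maximal_not1 : ~ m 1.
Proof. by case: localR => [[[]]]. Qed.

Lemma maximal_above J : is_ideal J -> m `<=` J -> J = m \/ J = setT.
Proof.
move=> hJ mJ; have [J1|nJ1] := pselect (J 1); first by right; exact: ideal_eqT.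
by left; case: localR => [[_ h] _]; exact: h.
Qed.

Lemma proper_sub_maximal I : is_ideal I -> ~ I 1 -> I `<=` m.
Proof.
move: I; apply: (noetherian_ind noethR) => I hI IH nI1.
have [[J [hJ IJ nJ1]]|h] := pselect (exists J, [/\ is_ideal J, I `<` J & ~ J 1]).
  by apply: subset_trans (IH J hJ IJ nJ1); case: IJ.
case: localR => _ /(_ I) -> //; split => // J [hJ nJ1] IJ.
apply/seteqP; split => //; apply: contrapT => JI.
by apply: h; exists J; split.
Qed.

Lemma open_sub I J : open_ideal I -> is_ideal J -> I `<=` J -> open_ideal J.
Proof.
by move=> [hI h] hJ IJ; split => // x /h [k]; exists k; exact: IJ.
Qed.

Lemma open_mul I J : open_ideal I -> open_ideal J -> open_ideal (ideal_mul I J).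
Proof.
move=> [hI h] [hJ h']; split; first exact: is_ideal_mul.
move=> x mx; have [i Ix] := h x mx; have [j Jx] := h' x mx; exists (i + j)%N.
by rewrite exprD; exact: mem_mul.
Qed.

Lemma open_exp I n : open_ideal I -> open_ideal (ideal_exp I n).
Proof.
move=> oI; elim: n => [|n IH]; last exact: open_mul.
by split; [exact: is_idealT|move=> x _; exists 0%N].
Qed.

(** [I / K] has a socle element: multiply an element of [I] outside [K] by
    powers of the generators of [m] for as long as it stays outside [K]. *)
Lemma socle_element I K : is_ideal I -> open_ideal K -> ~ (I `<=` K) ->
  exists y, [/\ I y, ~ K y & m `<=` colon_elt K y].
Proof.
move=> hI [hK oK] IK.
have [y0 [Iy0 nKy0]] : exists y, I y /\ ~ K y.
  apply: contrapT => h; apply: IK => y Iy; apply: contrapT => nKy.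
  by apply: h; exists y.
have [s ms] := noethR maximal_is_ideal.
have hs x : x \in s -> m x by rewrite ms => xs; exact: sub_gen.
suff [y [Iy nKy hy]] : exists y, [/\ I y, ~ K y & forall x, x \in s -> K (y * x)].
  exists y; split => //; rewrite ms; apply: gen_sub => //.
  exact: is_ideal_colon_elt.
elim: s hs {ms} => [|x s IH] hs; first by exists y0.
have [|y [Iy nKy hy]] := IH; first by move=> z zs; apply: hs; rewrite inE zs orbT.
have [k Kx] := oK x (hs x (mem_head _ _)).
have ex : exists k, `[< K (y * x ^+ k) >] by exists k; apply/asboolP; exact: idealMl.
case: (ex_minnP ex) => [[|j]] /asboolP Kj hj; first by case: nKy; rewrite mulr1 in Kj.
exists (y * x ^+ j); split; first exact: idealMr.
  by move=> /asboolP /hj; rewrite ltnn.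
move=> z; rewrite inE => /orP[/eqP ->|zs]; first by rewrite -mulrA -exprSr.
by rewrite mulrAC; apply: idealMr => //; exact: hy.
Qed.

Lemma colength_maximal : finite_colength m /\ colength m = 1%N.
Proof.
have hm := maximal_is_ideal.
have hb F l : chain (interval m setT) F l -> (l <= 1)%N.
  move=> [h1 h2]; case: l h1 h2 => [//|[//|l]] h1 h2; exfalso.
  have [i0 s0 _] := h1 0%N isT; have [i1 s1 _] := h1 1%N isT.
  have [i2 s2 _] := h1 2%N isT.
  have [l0 n0] := h2 0%N isT; have [l1 n1] := h2 1%N isT.
  case: (maximal_above i1 s1) => e1; last by apply: n1; rewrite e1.
  by apply: n0; rewrite e1.
have fm : finite_colength m by exists 1%N.
split => //; apply/eqP; rewrite eqn_leq colength_rlen rlen_le_bound //=.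
rewrite -[X in (X < _)%N](rlen_refl hm); apply: rlen_lt_r => //.
by split => // h; apply: maximal_not1; exact: h.
Qed.

(** By Noetherian induction: adjoin a socle element [y] and use the exact
    sequence [0 -> R/m -> R/I -> R/(I+(y)) -> 0]. *)
Lemma open_finite_colength I : open_ideal I -> finite_colength I.
Proof.
move=> oI; have hI := proj1 oI.
move: I hI oI; apply: (noetherian_ind noethR) => I hI IH oI.
have [I1|nI1] := pselect (I 1).
  by rewrite (ideal_eqT hI I1); exact: finite_colengthT.
have [|y [_ nIy my]] := socle_element (@is_idealT R) oI; first by move=> /(_ 1 Logic.I).
have hJ := is_ideal_add hI (is_ideal_principal y).
have IJ : I `<=` ideal_add I (principal y).
  by apply: ideal_add_subl; exact: is_ideal_principal.
have [] // := @colength_colon _ I y hI.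
  have [fm _] := colength_maximal.
  by have [] := colength_le (is_ideal_colon_elt y hI) my fm.
apply: IH => //; last exact: open_sub oI _ IJ.
by split => // h; apply: nIy; apply: h; exact: ideal_add_principal_gen.
Qed.

(** For a socle element [y], the quotient [(I + (y)) / I] is a copy of the
    residue field. *)
Lemma colength_socle I y : open_ideal I -> ~ I y -> m `<=` colon_elt I y ->
  colength I = (colength (ideal_add I (principal y))).+1.
Proof.
move=> oI nIy my; have hI := proj1 oI.
have hc := is_ideal_colon_elt y hI.
have ec : colon_elt I y = m.
  case: (maximal_above hc my) => // e; case: nIy.
  by have : colon_elt I y 1 by [rewrite e]; rewrite /colon_elt /= mulr1.
have [fm em] := colength_maximal.
have oJ : open_ideal (ideal_add I (principal y)).
  apply: open_sub oI _ _; first by apply: is_ideal_add => //; exact: is_ideal_principal.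
  by apply: ideal_add_subl; exact: is_ideal_principal.
have [|_ ->] := @colength_colon _ I y hI _ (open_finite_colength oJ); first by rewrite ec.
by rewrite ec em.
Qed.

Lemma colength_proper_gt0 I : open_ideal I -> ~ I 1 -> (0 < colength I)%N.
Proof.
move=> oI nI1; rewrite -(colengthT R); apply: colength_lt => //.
- by case: oI.
- by split => // h; apply: nI1; exact: h.
- exact: open_finite_colength.
Qed.

End Local.

(** * Injective modules and the socle of a complete intersection *)

Section IdealModule.
Variables (R : comNzRingType) (J : set R) (hJ : is_ideal J).

(** An ideal as a module. The proof that [J] is an ideal is a parameter of the
    type so that the module structure can be inferred from it. *)
Definition ideal_module : Type := (fun _ : is_ideal J => {x : R | `[< J x >]}) hJ.

HB.instance Definition _ := Choice.on ideal_module.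

Definition im_val (u : ideal_module) : R := proj1_sig u.

Lemma im_valP u : J (im_val u).
Proof. by case: u => x /= /asboolP. Qed.

Definition im_mk x (Jx : J x) : ideal_module := exist _ x (asboolT Jx).

Lemma im_val_inj : injective im_val. Proof. exact: val_inj. Qed.

Definition im_zero : ideal_module := im_mk (ideal0 hJ).
Definition im_opp u : ideal_module := im_mk (idealN hJ (im_valP u)).
Definition im_add u v : ideal_module := im_mk (idealD hJ (im_valP u) (im_valP v)).
Definition im_scale r u : ideal_module := im_mk (idealMl r hJ (im_valP u)).

Fact im_addA : associative im_add.
Proof. by move=> u v w; apply: im_val_inj; exact: addrA. Qed.
Fact im_addC : commutative im_add.
Proof. by move=> u v; apply: im_val_inj; exact: addrC. Qed.
Fact im_add0 : left_id im_zero im_add.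
Proof. by move=> u; apply: im_val_inj; exact: add0r. Qed.
Fact im_addN : left_inverse im_zero im_opp im_add.
Proof. by move=> u; apply: im_val_inj; exact: addNr. Qed.

HB.instance Definition _ :=
  GRing.isZmodule.Build ideal_module im_addA im_addC im_add0 im_addN.

Fact im_scaleA a b u : im_scale a (im_scale b u) = im_scale (a * b) u.
Proof. by apply: im_val_inj; exact: mulrA. Qed.
Fact im_scale1 : left_id 1 im_scale.
Proof. by move=> u; apply: im_val_inj; exact: mul1r. Qed.
Fact im_scaleDr : right_distributive im_scale +%R.
Proof. by move=> a u v; apply: im_val_inj; exact: mulrDr. Qed.
Fact im_scaleDl u : {morph im_scale^~ u : a b / a + b}.
Proof. by move=> a b; apply: im_val_inj; exact: mulrDl. Qed.

HB.instance Definition _ :=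
  GRing.Zmodule_isLmodule.Build R ideal_module im_scaleA im_scale1 im_scaleDr im_scaleDl.

Fact im_val_linear : linear (im_val : ideal_module -> R^o).
Proof. by []. Qed.

HB.instance Definition _ :=
  GRing.isLinear.Build R ideal_module R^o *:%R im_val im_val_linear.

(** A linear map defined on [J] only extends to [R], where it is
    multiplication of its value at [1]. *)
Lemma baer_extension (Q : lmodType R) (g : R -> Q) :
  injective_module Q ->
  (forall x y, J x -> J y -> g (x + y) = g x + g y) ->
  (forall r x, J x -> g (r * x) = r *: g x) ->
  exists q, forall x, J x -> g x = x *: q.
Proof.
move=> injQ gD gZ; pose g' (u : ideal_module) : Q := g (im_val u).
have lin : linear g'.
  move=> a u v; rewrite /g'.
  rewrite -[im_val (a *: u + v)]/(a * im_val u + im_val v).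
  rewrite gD ?gZ //; try exact: im_valP.
  by apply: idealMl => //; exact: im_valP.
pose g'L : {linear ideal_module -> Q} :=
  HB.pack g' (GRing.isLinear.Build R ideal_module Q *:%R g' lin).
have [h hh] := injQ _ _ (im_val : {linear ideal_module -> R^o}) g'L im_val_inj.
exists (h 1) => x Jx; rewrite -linearZ /=.
rewrite -[g x]/(g'L (im_mk Jx)) -hh; congr (h _).
by rewrite -[RHS]/(x * 1) mulr1.
Qed.

End IdealModule.

Section RegularIdeals.
Variable R : comNzRingType.

(** Ideals generated by a regular sequence, with the sequence forgotten. *)
Inductive regular_ideal : nat -> set R -> Prop :=
| regular_ideal0 : regular_ideal 0 [set 0]
| regular_idealS k b y : regular_ideal k b -> (forall r, b (y * r) -> b r) ->
    regular_ideal k.+1 (ideal_add b (principal y)).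

Lemma regular_ideal_ideal k b : regular_ideal k b -> is_ideal b.
Proof.
elim=> [|{}k {}b y _ hb _]; first exact: is_ideal_zero.
by apply: is_ideal_add => //; exact: is_ideal_principal.
Qed.

Lemma complete_intersectionP c : complete_intersection c ->
  ~ c 1 /\ exists k, regular_ideal k c.
Proof.
move=> [s [[hreg h1] ->]]; split => //; exists (size s).
suff h k : (k <= size s)%N -> regular_ideal k (ideal_gen [set` take k s]).
  by have := h _ (leqnn _); rewrite take_size.
elim: k => [|k IH] hk; first by rewrite take0 gen_nil; exact: regular_ideal0.
rewrite (take_nth 0) // gen_rcons; apply: regular_idealS; first exact/IH/ltnW.
by move=> r; exact: hreg.
Qed.

End RegularIdeals.

Section InjectiveResolution.
Variable R : comNzRingType.
Variables (n : nat) (E : nat -> lmodType R) (e : {linear R^o -> E 0%N}).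
Variable d : forall i, {linear E i -> E i.+1}.
Hypothesis injE : forall i, injective_module (E i).
Hypothesis injective_e : injective e.
Hypothesis exact0 : forall x, d 0%N x = 0 <-> exists y, e y = x.
Hypothesis exactS : forall i x, d i.+1 x = 0 <-> exists y, d i y = x.
Hypothesis bounded : forall i, (n < i)%N -> forall x : E i, x = 0.
Implicit Types (I J K b c : set R) (y r s : R) (i : nat).

(** [torsion I] is [Hom (R / I, E i)]; the cocycles and coboundaries of the
    complex formed by these modules compute [Ext (R / I, R)]. *)
Definition torsion I i (x : E i) : Prop := forall r, I r -> r *: x = 0.

Definition coboundary I i : E i -> Prop :=
  match i return E i -> Prop with
  | 0%N => fun x => x = 0
  | i'.+1 => fun x => exists w : E i', torsion I w /\ d i' w = x
  end.

Definition ext_vanishes I i : Prop :=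
  forall x : E i, torsion I x -> d i x = 0 -> coboundary I x.

Lemma d_d i (x : E i) : d i.+1 (d i x) = 0.
Proof. by apply/exactS; exists x. Qed.

Lemma torsionB I i (x y : E i) : torsion I x -> torsion I y -> torsion I (x - y).
Proof. by move=> hx hy r Ir; rewrite scalerBr hx // hy // subr0. Qed.

Lemma torsionZ I i r (x : E i) : torsion I x -> torsion I (r *: x).
Proof. by move=> hx s Is; rewrite scalerA mulrC -scalerA hx // scaler0. Qed.

Lemma torsion_d I i (x : E i) : torsion I x -> torsion I (d i x).
Proof. by move=> hx r Ir; rewrite -linearZ /= hx // linear0. Qed.

Lemma torsion_sub I J i (x : E i) : I `<=` J -> torsion J x -> torsion I x.
Proof. by move=> IJ hx r Ir; apply: hx; exact: IJ. Qed.

Lemma torsion_add I y i (x : E i) :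
  torsion I x -> y *: x = 0 -> torsion (ideal_add I (principal y)) x.
Proof.
move=> hx hy _ [u [_ [Iu [r _ ->] ->]]].
by rewrite scalerDl hx // add0r mulrC -scalerA hy scaler0.
Qed.

Lemma coboundary_torsion I i (x : E i) : coboundary I x -> torsion I x.
Proof.
case: i x => [|i] x /=; first by move=> -> r _; rewrite scaler0.
by move=> [w [hw <-]]; exact: torsion_d.
Qed.

Lemma coboundary_cocycle I i (x : E i) : coboundary I x -> d i x = 0.
Proof.
case: i x => [|i] x /=; first by move=> ->; rewrite linear0.
by move=> [w [hw <-]]; exact: d_d.
Qed.

Lemma coboundary0 I i : coboundary I (0 : E i).
Proof.
case: i => [//|i] /=; exists 0; split; last by rewrite linear0.
by move=> r _; rewrite scaler0.
Qed.

(** Multiplication by [y] carries [Hom (R / I, E)] to [Hom (R / K, E)] when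
    [y K] lies in [I]. *)
Lemma coboundary_scale I K y i (x : E i) :
  K `<=` colon_elt I y -> coboundary I x -> coboundary K (y *: x).
Proof.
case: i x => [|i] x /= hK; first by move=> ->; rewrite scaler0.
move=> [w [hw <-]]; exists (y *: w); split; last by rewrite linearZ.
by move=> r Kr; rewrite scalerA mulrC; apply: hw; exact: hK.
Qed.

(** Injectivity of [E i] along the embedding [R/(I:y) -> R/I] given by
    multiplication by [y]. *)
Lemma torsion_divide I y i (x : E i) : is_ideal I ->
  torsion (colon_elt I y) x -> exists w, torsion I w /\ y *: w = x.
Proof.
move=> hI hx.
(* The map [i + y r |-> r x] is well defined on [I + (y)], because two choices
   of [r] differ by an element of [I : y], which annihilates [x]; [rho] makes
   such a choice. *)
pose rho z := xget 0 [set r | I (z - y * r)].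
have rhoP z : ideal_add I (principal y) z -> I (z - y * rho z).
  move=> [u [_ [Iu [r _ ->] ->]]].
  suff : [set r' | I (u + y * r - y * r')] (rho (u + y * r)) by [].
  by apply: xgetPex; exists r; rewrite /= addrK.
have rho_eq z r : ideal_add I (principal y) z -> I (z - y * r) -> rho z *: x = r *: x.
  move=> Jz Ir; apply/eqP; rewrite -subr_eq0 -scalerBl; apply/eqP; apply: hx.
  rewrite /colon_elt /=.
  have -> : y * (rho z - r) = (z - y * r) - (z - y * rho z) by ring.
  by apply: idealB => //; exact: rhoP.
have hJ := is_ideal_add hI (is_ideal_principal y).
have [| |q hq] := baer_extension hJ (g := fun z => rho z *: x) (@injE i).
- move=> z1 z2 J1 J2; rewrite -scalerDl; apply: rho_eq; first exact: idealD.
  have -> : z1 + z2 - y * (rho z1 + rho z2) = (z1 - y * rho z1) + (z2 - y * rho z2).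
    by ring.
  by apply: idealD => //; exact: rhoP.
- move=> r z Jz; rewrite scalerA; apply: rho_eq; first exact: idealMl.
  have -> : r * z - y * (r * rho z) = r * (z - y * rho z) by ring.
  by apply: idealMl => //; exact: rhoP.
exists q; split.
  move=> r Ir; rewrite -hq; last by apply: ideal_add_subl => //; exact: is_ideal_principal.
  rewrite (rho_eq r 0) ?scale0r // ?mulr0 ?subr0 //.
  by apply: ideal_add_subl => //; exact: is_ideal_principal.
rewrite -hq; last exact: ideal_add_principal_gen.
rewrite (rho_eq y 1) ?scale1r // ?mulr1 ?subrr; first exact: ideal_add_principal_gen.
exact: ideal0.
Qed.

Lemma coboundary_divide I K y i (x : E i) : is_ideal I -> colon_elt I y `<=` K ->
  coboundary K x -> exists x', coboundary I x' /\ y *: x' = x.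
Proof.
case: i x => [|i] x hI hK /=; first by move=> ->; exists 0; rewrite scaler0.
move=> [w [hw <-]].
have [w' [hw' <-]] := torsion_divide hI (torsion_sub hK hw).
by exists (d i w'); split; [exists w'|rewrite linearZ].
Qed.

(** [Ext^k (R / c, R)] is free of rank one over [R / c]. *)
Definition ext_free c k : Prop := exists z : E k,
  [/\ torsion c z, d k z = 0,
      forall x : E k, torsion c x -> d k x = 0 -> exists r, coboundary c (x - r *: z)
    & forall r, coboundary c (r *: z) -> c r].

(** The long exact sequence of [0 -> R/b -> R/b -> R/(b+(y)) -> 0], whose first
    map is multiplication by [y], gives the passage from [b] to [b + (y)]: in
    degree [k + 1] the cokernel of [y] on [R/b] appears, and above it
    everything vanishes. *)
Lemma regular_ideal_ext k c : regular_ideal k c ->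
  ext_free c k /\ forall i, (k < i)%N -> ext_vanishes c i.
Proof.
elim=> [|{}k b y hreg [[z [tz dz genz injz]] van] hy].
  split.
    exists (e 1); split.
    - by move=> r ->; rewrite scale0r.
    - by apply/exact0; exists 1.
    - move=> x _ /exact0 [r <-]; exists r; rewrite /= -linearZ /=.
      by rewrite -[r *: _]/(r * 1) mulr1 subrr.
    - move=> r /=; rewrite -linearZ /= -[r *: _]/(r * 1) mulr1 => er.
      by apply: injective_e; rewrite er linear0.
  move=> [//|i] _ x _ /exactS [w <-]; exists w; split => //.
  by move=> r ->; rewrite scale0r.
have hb := regular_ideal_ideal hreg.
clear c; set c := ideal_add b _.
have bc : b `<=` c by apply: ideal_add_subl; exact: is_ideal_principal.
have cy : c y by exact: ideal_add_principal_gen.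
have hcol : colon_elt b y `<=` b by move=> r; exact: hy.
(* If [y u] is a coboundary, it is [y] times a cocycle; subtracting the latter
   from [u] leaves [d u] unchanged and makes [u] annihilated by [y]. *)
have descend i (u x : E i) : torsion b u -> coboundary b x -> y *: u = x ->
    exists u', torsion c u' /\ d i u' = d i u.
  move=> tu hx yu; have [x' [hx' yx']] := coboundary_divide hb hcol hx.
  exists (u - x'); split; last by rewrite linearB (coboundary_cocycle hx') subr0.
  apply: torsion_add; first exact: torsionB tu (coboundary_torsion hx').
  by rewrite scalerBr yu yx' subrr.
split; last first.
  move=> [//|i] hi x tx dx.
  have [u [tu du]] := van i.+1 (ltnW hi) x (torsion_sub bc tx) dx.
  have hyu : coboundary b (y *: u).
    apply: (van i) => //; first exact: torsionZ.
    by rewrite linearZ /= du tx.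
  by have [u' [tu' du']] := descend i u _ tu hyu erefl; exists u'; rewrite du'.
(* The image of [z] under the connecting homomorphism. *)
have [w [tw yw]] := torsion_divide hb (torsion_sub hcol tz).
exists (d k w); split.
- by apply: torsion_add; [exact: torsion_d|rewrite -linearZ /= yw dz].
- exact: d_d.
- move=> x tx dx.
  have [u [tu du]] := van k.+1 (ltnSn k) x (torsion_sub bc tx) dx.
  have [r hr] : exists r, coboundary b (y *: u - r *: z).
    by apply: genz; [exact: torsionZ|rewrite linearZ /= du tx].
  exists r; have turw : torsion b (u - r *: w) by apply: torsionB => //; exact: torsionZ.
  have [|u' [tu' du']] := descend k (u - r *: w) _ turw hr.
    by rewrite scalerBr scalerA mulrC -scalerA yw.
  by exists u'; split => //; rewrite du' linearB linearZ /= du.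
- move=> r [t [tt dt]].
  have [s hs] : exists s, coboundary b ((r *: w - t) - s *: z).
    apply: genz; last by rewrite linearB linearZ /= dt subrr.
    by apply: torsionB; [exact: torsionZ|exact: torsion_sub tt].
  have := coboundary_scale (y := y) (K := b) _ hs.
  rewrite !scalerBr tt // subr0 scalerA mulrC -scalerA yw scalerA -scalerBl.
  move=> /(_ (fun r br => idealMl y hb br)) /injz br.
  rewrite -(subrK (y * s) r); apply: idealD; first exact: is_ideal_add hb (is_ideal_principal y).
    exact: bc.
  exact: idealMr (is_ideal_add hb (is_ideal_principal y)) cy.
Qed.

Variable m : set R.
Hypothesis noethR : noetherian R.
Hypothesis localR : local_ring m.
Variables (dim : nat) (c : set R).
Hypothesis regc : regular_ideal dim c.
Hypothesis openc : open_ideal m c.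
Hypothesis properc : ~ c 1.

Let hc : is_ideal c. Proof. by case: openc. Qed.

(** The exact sequence of [0 -> R/m -> R/c -> R/(c+(y)) -> 0] at
    [Ext^i (R/m, R)]. *)
Lemma ext_residue_divide y i (x : E i) :
  colon_elt c y `<=` m -> ext_vanishes (ideal_add c (principal y)) i.+1 ->
  torsion m x -> d i x = 0 ->
  exists w, [/\ torsion c w, d i w = 0 & y *: w = x].
Proof.
move=> hm van tx dx.
have [w [tw yw]] := torsion_divide hc (torsion_sub hm tx).
have [||u [tu du]] := van (d i w); last first.
- exists (w - u); split.
  + apply: torsionB => //; apply: torsion_sub tu.
    by apply: ideal_add_subl; exact: is_ideal_principal.
  + by rewrite linearB /= du subrr.
  + rewrite scalerBr yw tu ?subr0 //; exact: ideal_add_principal_gen.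
- exact: d_d.
- by apply: torsion_add; [exact: torsion_d|rewrite -linearZ /= yw dx].
Qed.

Lemma colon_socle_proper y I : is_ideal I -> ~ I y -> m `<=` colon_elt I y ->
  colon_elt I y `<=` m.
Proof.
move=> hI nIy my; case: (maximal_above localR (is_ideal_colon_elt y hI) my) => [->//|colT].
by case: nIy; have : colon_elt I y 1 by [rewrite colT]; rewrite /colon_elt /= mulr1.
Qed.

(** A finite injective resolution forces [Ext^i (R/J, R)] to vanish above the
    length of the regular sequence: a nonzero class in the top degree would
    lift from [R/m] to [R/c]. *)
Lemma ext_vanishes_above J i : is_ideal J -> c `<=` J -> (dim < i)%N ->
  ext_vanishes J i.
Proof.
move=> hJ cJ hi.
have [t ht] : exists t, (n < i + t)%N by exists n.+1; rewrite addnS ltnS leq_addl.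
elim: t i hi ht J hJ cJ => [|t IH] i hi ht.
  move=> J _ _ x _ _; rewrite addn0 in ht.
  by rewrite (bounded ht x); exact: coboundary0.
have [_ vanc] := regular_ideal_ext regc.
(* A socle element embeds [R/m] in [R/c], so that a class on [R/m] lifts to
   one on [R/c], where [i] is above the surviving degree. *)
have van_m : ext_vanishes m i.
  move=> x tx dx.
  have [|y [_ ncy my]] := socle_element noethR localR (@is_idealT R) openc.
    by move=> /(_ 1 Logic.I).
  have [|w [tw dw <-]] := ext_residue_divide (colon_socle_proper hc ncy my) _ tx dx.
    apply: IH; [exact: ltnW|by rewrite addSnnS| |].
      by apply: is_ideal_add => //; exact: is_ideal_principal.
    by apply: ideal_add_subl; exact: is_ideal_principal.
  exact: coboundary_scale my (vanc i hi w tw dw).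
(* The general case follows by adding one socle element of [R/J] at a time. *)
apply: (noetherian_ind noethR) => J hJ IHJ cJ x tx dx.
have [J1|nJ1] := pselect (J 1).
  by rewrite -(scale1r x) tx //; exact: coboundary0.
have oJ := open_sub openc hJ cJ.
have [|y [_ nJy my]] := socle_element noethR localR (@is_idealT R) oJ.
  by move=> /(_ 1 Logic.I).
set J' := ideal_add J (principal y).
have JJ' : J `<=` J' by apply: ideal_add_subl; exact: is_ideal_principal.
have hyx : coboundary m (y *: x).
  apply: van_m; last by rewrite linearZ /= dx scaler0.
  by move=> r mr; rewrite scalerA mulrC; apply: tx; exact: my.
have [x' [hx' yx']] := coboundary_divide hJ (colon_socle_proper hJ nJy my) hyx.
have : coboundary J' (x - x').
  apply: IHJ.
  - by apply: is_ideal_add => //; exact: is_ideal_principal.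
  - by split => // /(_ y (ideal_add_principal_gen _ hJ)).
  - exact: subset_trans JJ'.
  - apply: torsion_add; first exact: torsionB tx (coboundary_torsion hx').
    by rewrite scalerBr yx' subrr.
  - by rewrite linearB /= dx (coboundary_cocycle hx') subr0.
case: i x x' hx' {hi ht IH vanc van_m IHJ tx dx hyx yx'} => [|i] x x' /=.
  by move=> -> ; rewrite subr0.
move=> [w [tw dw]] [w' [tw' dw']]; exists (w + w'); split.
  by move=> r Jr; rewrite scalerDr tw // (torsion_sub JJ' tw') // addr0.
by rewrite linearD /= dw dw' addrC subrK.
Qed.

(** The image of [Ext (R/m, R)] in [Ext (R/c, R)], a copy of [R/c], is both
    [y (R/c)] and [y' (R/c)] for any two nonzero socle elements of [R/c]. *)
Lemma socle_simple y y' : ~ c y -> m `<=` colon_elt c y -> m `<=` colon_elt c y' ->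
  ideal_add c (principal y) y'.
Proof.
move=> ncy my my'; have [[z [tz dz genz injz]] _] := regular_ideal_ext regc.
have hcy := is_ideal_add hc (is_ideal_principal y).
have ccy : c `<=` ideal_add c (principal y).
  by apply: ideal_add_subl; exact: is_ideal_principal.
have [|||w [tw dw yw]] := ext_residue_divide (colon_socle_proper hc ncy my) (x := y' *: z).
- exact: ext_vanishes_above.
- by move=> r mr; rewrite scalerA mulrC; apply: tz; exact: my'.
- by rewrite linearZ /= dz scaler0.
have [s hs] := genz w tw dw.
have : c (y' - y * s).
  apply: injz; have := coboundary_scale (y := y) (K := c) _ hs.
  rewrite scalerBr yw scalerA -scalerBl; apply.
  by move=> r cr; exact: idealMl.
move=> /ccy h; rewrite -(subrK (y * s) y'); apply: idealD => //.
by apply: idealMr => //; exact: ideal_add_principal_gen.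
Qed.

End InjectiveResolution.

(** * Linkage and colength *)

Section LinkageLength.
Variables (R : comNzRingType) (m : set R).
Hypothesis gorR : gorenstein_local m.
Variables (dim : nat) (c : set R).
Hypothesis regc : regular_ideal dim c.
Hypothesis openc : open_ideal m c.
Hypothesis properc : ~ c 1.
Implicit Types (I J K a : set R) (x y z : R).

Let noethR : noetherian R. Proof. by case: gorR. Qed.
Let localR : local_ring m. Proof. by case: gorR. Qed.
Let hc : is_ideal c. Proof. by case: openc. Qed.

Lemma gorenstein_socle_simple y y' :
  ~ c y -> m `<=` colon_elt c y -> m `<=` colon_elt c y' ->
  ideal_add c (principal y) y'.
Proof.
have [_ _ [n [E [e [d [injE inje ex0 exS bnd]]]]]] := gorR.
exact: (socle_simple injE inje ex0 exS bnd noethR localR regc openc properc).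
Qed.

Lemma sub_colon K : is_ideal K -> c `<=` colon c K.
Proof. by move=> hK x cx z _; exact: idealMr. Qed.

Lemma colon_add_principal K y r :
  colon c K r -> c (r * y) -> colon c (ideal_add K (principal y)) r.
Proof.
move=> hr ry _ [u [_ [Ku [s _ ->] ->]]]; rewrite mulrDr mulrA.
by apply: idealD => //; [exact: hr|exact: idealMr].
Qed.

(** [(c : K) / (c : K + (y))] embeds in the socle of [R / c] by
    multiplication by [y]. *)
Lemma colength_colon_step K y : is_ideal K -> c `<=` K -> m `<=` colon_elt K y ->
  (colength (colon c (ideal_add K (principal y))) <= (colength (colon c K)).+1)%N.
Proof.
move=> hK cK my; set J := ideal_add K (principal y).
have hJ : is_ideal J by apply: is_ideal_add => //; exact: is_ideal_principal.
have KJ : K `<=` J by apply: ideal_add_subl; exact: is_ideal_principal.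
have hcJ : is_ideal (colon c J) by exact: is_ideal_colon.
have hcK : is_ideal (colon c K) by exact: is_ideal_colon.
have ocJ : open_ideal m (colon c J) := open_sub openc hcJ (sub_colon hJ).
have ocK : open_ideal m (colon c K) := open_sub openc hcK (sub_colon hK).
have soc w : colon c K w -> m `<=` colon_elt c (w * y).
  by move=> hw r mr; rewrite /colon_elt /= -mulrA; apply: hw; exact: my.
have [le|nle] := pselect (colon c K `<=` colon c J).
  have [_ h] := colength_le hcJ le (open_finite_colength noethR localR ocK).
  exact: leq_trans h (leqnSn _).
have [z [Kz nJz]] : exists z, colon c K z /\ ~ colon c J z.
  apply: contrapT => h; apply: nle => z Kz; apply: contrapT => nJz.
  by apply: h; exists z.
have nczy : ~ c (z * y) by move=> h; apply: nJz; exact: colon_add_principal.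
have gen : colon c K `<=` ideal_add (colon c J) (principal z).
  move=> w Kw.
  have [u [_ [cu [r _ ->] wy]]] := gorenstein_socle_simple nczy (soc z Kz) (soc w Kw).
  rewrite -(subrK (z * r) w); exists (w - z * r), (z * r); split => //; last by exists r.
  apply: colon_add_principal.
    exact: (idealB hcK Kw (idealMr r hcK Kz)).
  by rewrite mulrBl wy (mulrAC z r) addrK.
have mz : m `<=` colon_elt (colon c J) z.
  move=> r mr; apply: colon_add_principal; first exact: (idealMr r hcK Kz).
  by rewrite mulrAC; exact: soc.
have [fm em] := colength_maximal localR.
have [f1 l1] := colength_le (is_ideal_colon_elt z hcJ) mz fm.
have hz := is_ideal_add hcJ (is_ideal_principal z).
have [f2 l2] := colength_le hz gen (open_finite_colength noethR localR ocK).
have [_ ->] := colength_colon hcJ f1 f2.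
by rewrite -add1n -em; exact: leq_add.
Qed.

(** When [K] is enlarged by a socle element of [R/K], its colength drops by one
    and that of [c : K] rises by at most one. *)
Lemma colength_link_antitone K I : is_ideal K -> is_ideal I -> c `<=` K -> K `<=` I ->
  (colength I + colength (colon c I) <= colength K + colength (colon c K))%N.
Proof.
move=> hK hI; move: K hK; apply: (noetherian_ind noethR) => K hK IH cK KI.
have [IK|nIK] := pselect (I `<=` K).
  by have -> : I = K by apply/seteqP.
have oK := open_sub openc hK cK.
have [y [Iy nKy my]] := socle_element noethR localR hI oK nIK.
set J := ideal_add K (principal y).
have hJ : is_ideal J by apply: is_ideal_add => //; exact: is_ideal_principal.
have KJ : K `<=` J by apply: ideal_add_subl; exact: is_ideal_principal.
have {IH} h : (colength I + colength (colon c I) <= colength J + colength (colon c J))%N.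
  apply: IH => //.
  - by split => // /(_ y (ideal_add_principal_gen _ hK)).
  - exact: subset_trans KJ.
  - by apply: ideal_add_lub => //; exact: principal_sub.
apply: leq_trans h _; rewrite (colength_socle noethR localR oK nKy my) addSnnS leq_add2l.
exact: colength_colon_step.
Qed.

(** The sum of the colengths of [K] and of [c : K] is monotone along
    [c `<=` a `<=` R] and has the value [colength c] at both ends. *)
Lemma colength_linked a : is_ideal a -> c `<=` a ->
  (colength a + colength (colon c a))%N = colength c.
Proof.
move=> ha ca; apply/eqP; rewrite eqn_leq; apply/andP; split.
  have -> : colength c = (colength c + colength (colon c c))%N.
    have -> : colon c c = setT.
      by apply/seteqP; split => // r _ x cx; exact: idealMl.
    by rewrite colengthT addn0.
  exact: colength_link_antitone.
have -> : colength c = (colength (@setT R) + colength (colon c setT))%N.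
  have -> : colon c setT = c.
    apply/seteqP; split; last exact: sub_colon (@is_idealT R).
    by move=> r /(_ 1 Logic.I); rewrite mulr1.
  by rewrite colengthT.
by apply: colength_link_antitone => //; exact: is_idealT.
Qed.

End LinkageLength.

(** * Powers of an ideal generated by a regular sequence *)

Section RegularPowers.
Variable R : comNzRingType.
Implicit Types (I J K b c q : set R) (x y z u : R).

(** The kernel of [b^n -> b^n / (b^(n+1) + q b^n)]. For [b] generated by a
    regular sequence this quotient is the degree [n] part of a polynomial ring
    over [R / (b + q)]; letting [q] vary makes the induction on the length of
    the sequence possible. *)
Definition graded_kernel b q n : set R :=
  ideal_add (ideal_exp b n.+1) (ideal_mul q (ideal_exp b n)).

Lemma is_ideal_graded_kernel b q n : is_ideal (graded_kernel b q n).
Proof. by apply: is_ideal_add; [exact: is_ideal_exp|exact: is_ideal_mul]. Qed.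

Lemma graded_kernel_sub b q n : graded_kernel b q n `<=` ideal_exp b n.
Proof.
have h := is_ideal_exp b n.
by apply: ideal_add_lub => //; [exact: ideal_expS_sub|exact: ideal_mul_subr].
Qed.

Lemma graded_kernel0 b q : is_ideal b -> is_ideal q ->
  graded_kernel b q 0 = ideal_add b q.
Proof. by move=> hb hq; rewrite /graded_kernel ideal_exp1 // ideal_mul1. Qed.

Lemma graded_kernel_zero b n : graded_kernel b [set 0] n = ideal_exp b n.+1.
Proof.
apply: ideal_addK; [exact: is_ideal_mul|exact: is_ideal_exp|].
apply: ideal_mul_sub; first exact: is_ideal_exp.
by move=> x y -> _; rewrite mul0r; exact: (ideal0 (is_ideal_exp b n.+1)).
Qed.

Lemma ideal_add_principalCA b q y : is_ideal b -> is_ideal q ->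
  ideal_add b (ideal_add q (principal y)) = ideal_add (ideal_add b (principal y)) q.
Proof.
move=> hb hq; apply/seteqP; split.
  move=> _ [u [_ [bu [v [w [qv yw ->]]] ->]]].
  exists (u + w), v; split => //; first by exists u, w.
  by rewrite addrA addrAC.
move=> _ [_ [v [[u [w [bu yw ->]]] qv ->]]].
exists u, (v + w); split => //; first by exists v, w.
by rewrite addrAC addrA.
Qed.

(** Elements regular on the degree [0] part of the associated graded module are
    regular on all of it. When [b] is generated by a regular sequence, this
    stands in for the quasi-regularity of the sequence. *)
Definition regular_on_graded b : Prop :=
  forall q z, is_ideal q ->
    (forall u, ideal_add b q (z * u) -> ideal_add b q u) ->
  forall n u, ideal_exp b n u -> graded_kernel b q n (z * u) -> graded_kernel b q n u.

(** An element regular on all the quotients [b^i / b^(i+1)] is regular on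
    [R / b^n]. *)
Lemma regular_mod_exp b y : is_ideal b -> regular_on_graded b ->
  (forall u, b (y * u) -> b u) ->
  forall n u, ideal_exp b n (y * u) -> ideal_exp b n u.
Proof.
move=> hb hreg hy; elim=> [//|n IH] u hu.
have e0 : ideal_add b [set 0] = b.
  by apply: ideal_addK => //; [exact: is_ideal_zero|move=> _ ->; exact: ideal0].
have := hreg [set 0] y (is_ideal_zero R); rewrite e0 => /(_ hy n u).
by rewrite !graded_kernel_zero; apply => //; apply: IH; exact: ideal_expS_sub hu.
Qed.

Section AddElement.
Variables (b : set R) (y : R).
Hypotheses (hb : is_ideal b) (hreg : regular_on_graded b).
Hypothesis hy : forall u, b (y * u) -> b u.
Let c := ideal_add b (principal y).

Let hc : is_ideal c.
Proof. by apply: is_ideal_add => //; exact: is_ideal_principal. Qed.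
Let bc : b `<=` c.
Proof. by apply: ideal_add_subl; exact: is_ideal_principal. Qed.
Let cy : c y. Proof. exact: ideal_add_principal_gen. Qed.
Let yexp n u : ideal_exp b n (y * u) -> ideal_exp b n u.
Proof. exact: regular_mod_exp. Qed.

Lemma graded_kernelS q n : is_ideal q ->
  graded_kernel c q n.+1 =
  ideal_add (graded_kernel b q n.+1) (ideal_scale y (graded_kernel c q n)).
Proof.
move=> hq; have hk1 := is_ideal_graded_kernel b q n.+1.
have hk2 := is_ideal_graded_kernel c q n.
have hk3 := is_ideal_graded_kernel c q n.+1.
have hs := is_ideal_add hk1 (is_ideal_scale y hk2).
apply/seteqP; split; apply: ideal_add_lub => //.
- rewrite ideal_exp_add_principal //; apply: ideal_add_mono.
    by apply: ideal_add_subl; exact: is_ideal_mul.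
  move=> _ [k ck ->]; exists k => //.
  by apply: ideal_add_subl => //; exact: is_ideal_mul.
- apply: ideal_mul_sub => // x w qx; rewrite ideal_exp_add_principal //.
  move=> [u [_ [bu [v cv ->] ->]]]; rewrite mulrDr.
  exists (x * u), (y * (x * v)); split.
  + by apply: ideal_add_subr; [exact: is_ideal_exp|exact: mem_mul].
  + exists (x * v) => //.
    by apply: ideal_add_subr; [exact: is_ideal_exp|exact: mem_mul].
  + by rewrite (mulrCA x).
- apply: ideal_add_mono; first exact: ideal_exp_mono.
  by apply: ideal_mul_mono => //; exact: ideal_exp_mono.
- move=> _ [_ [u [v [cu qv ->]]] ->]; rewrite mulrDr; exists (y * u), (y * v).
  split => //; first exact: mem_mul.
  suff : ideal_mul q (ideal_exp c n) `<=` colon_elt (ideal_mul q (ideal_exp c n.+1)) y.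
    exact.
  apply: ideal_mul_sub; first exact/is_ideal_colon_elt/is_ideal_mul.
  move=> s t qs ct; rewrite /colon_elt /= mulrCA.
  by apply: mem_mul => //; exact: mem_mul.
Qed.

Lemma graded_kernel_colon q n u : is_ideal q ->
  graded_kernel c q n.+1 (y * u) -> graded_kernel c q n u.
Proof.
move=> hq; rewrite graded_kernelS // => -[w [_ [bw [v cv ->] yu]]].
have : ideal_exp b n.+1 (u - v).
  apply: yexp; rewrite mulrBr yu addrK; exact: graded_kernel_sub bw.
move=> /(ideal_exp_mono bc) h; rewrite -(subrK v u).
apply: (idealD (is_ideal_graded_kernel c q n)) => //.
by apply: ideal_add_subl => //; exact: is_ideal_mul.
Qed.

(** Regularity of [y] modulo [b^n] puts [v] in [b^n]. *)
Lemma graded_kernel_add_principal q n v w : is_ideal q ->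
  graded_kernel b q n w -> ideal_exp b n (w + y * v) ->
  graded_kernel b (ideal_add q (principal y)) n (w + y * v).
Proof.
move=> hq bw bx; have bv : ideal_exp b n v.
  apply: yexp; apply: (ideal_addl_cancel (is_ideal_exp b n) _ bx).
  exact: graded_kernel_sub bw.
move: bw => [s [t [bs qt ->]]].
rewrite -addrA; exists s, (t + y * v); split => //.
apply: (idealD (is_ideal_mul _ _)).
  by apply: ideal_mul_mono qt => //; apply: ideal_add_subl; exact: is_ideal_principal.
by apply: mem_mul => //; exact: ideal_add_principal_gen.
Qed.

Lemma graded_kernel_add_principal_sub q n : is_ideal q ->
  graded_kernel b (ideal_add q (principal y)) n `<=`
  ideal_add (graded_kernel b q n) (ideal_scale y (ideal_exp b n)).
Proof.
move=> hq; have hk := is_ideal_graded_kernel b q n.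
have hs := is_ideal_scale y (is_ideal_exp b n).
have h := is_ideal_add hk hs.
apply: ideal_add_lub => //.
  apply: (@subset_trans _ (graded_kernel b q n)); last exact: ideal_add_subl.
  by apply: ideal_add_subl; exact: is_ideal_mul.
apply: ideal_mul_sub => // _ t [u [_ [qu [r _ ->] ->]]] bt.
rewrite mulrDl; exists (u * t), (y * r * t); split => //.
  by apply: ideal_add_subr; [exact: is_ideal_exp|exact: mem_mul].
exists (r * t); last by rewrite mulrA.
exact: (idealMl r (is_ideal_exp b n) bt).
Qed.

(** Write [u = u0 + y u'] with [u0] in [b^(n+1)]. Modulo [y] the claim for [u0]
    is the one for [b] and [q + (y)]; the rest is divisible by [y], which can
    be cancelled, and the degree goes down. *)
Lemma regular_on_graded_add : regular_on_graded c.
Proof.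
move=> q z hq hz; elim=> [|n IH] u.
  by rewrite graded_kernel0 // => _; exact: hz.
rewrite {1}ideal_exp_add_principal // => -[u0 [_ [bu0 [u' cu' ->] ->]]] hzu.
have hk := is_ideal_graded_kernel c q n.+1.
have sub_k : graded_kernel b q n.+1 `<=` graded_kernel c q n.+1.
  rewrite graded_kernelS //; apply: ideal_add_subl.
  exact/is_ideal_scale/is_ideal_graded_kernel.
have hu0 : graded_kernel c q n.+1 u0.
  suff : graded_kernel b (ideal_add q (principal y)) n.+1 u0.
    move=> /(graded_kernel_add_principal_sub hq); apply: ideal_add_lub => //.
    move=> _ [k bk ->]; apply: ideal_add_subl; first exact: is_ideal_mul.
    by apply: mem_mul => //; exact: ideal_exp_mono bk.
  apply: (hreg (z := z)) => //.
  - by apply: is_ideal_add => //; exact: is_ideal_principal.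
  - by rewrite ideal_add_principalCA.
  - move: (hzu); rewrite graded_kernelS // => -[w [_ [bw [v cv ->] zu]]].
    have e : z * u0 = w + y * (v - z * u').
      by rewrite mulrBr addrA -zu; ring.
    rewrite e; apply: graded_kernel_add_principal => //.
    rewrite -e; exact: (idealMl z (is_ideal_exp b n.+1) bu0).
apply: (idealD hk) => //.
have hzu' : graded_kernel c q n (z * u').
  apply: graded_kernel_colon => //.
  have -> : y * (z * u') = z * (u0 + y * u') - z * u0 by ring.
  apply: (idealB hk) => //; exact: (idealMl z hk hu0).
rewrite graded_kernelS //; apply: ideal_add_subr; first exact: is_ideal_graded_kernel.
by exists u' => //; exact: IH.
Qed.

(** Filtering [c^(n+1)] by [y c^n] splits the graded piece of [c] into one
    of [b] and the previous one of [c]. *)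
Lemma rlen_gradedS q n : is_ideal q ->
  let q' := ideal_add q (principal y) in
  finlen (graded_kernel b q' n.+1) (ideal_exp b n.+1) ->
  finlen (graded_kernel c q n) (ideal_exp c n) ->
  finlen (graded_kernel c q n.+1) (ideal_exp c n.+1) /\
  rlen (graded_kernel c q n.+1) (ideal_exp c n.+1) =
    (rlen (graded_kernel b q' n.+1) (ideal_exp b n.+1)
     + rlen (graded_kernel c q n) (ideal_exp c n))%N.
Proof.
move=> hq q' f1 f2; set G := graded_kernel c q n.+1.
have hG : is_ideal G := is_ideal_graded_kernel c q n.+1.
have hcn := is_ideal_exp c n; have hbn := is_ideal_exp b n.+1.
set M := ideal_add G (ideal_scale y (ideal_exp c n)).
have hycn := is_ideal_scale y hcn.
have hM : is_ideal M by exact: is_ideal_add.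
have GM : G `<=` M by exact: ideal_add_subl.
have yM : ideal_scale y (ideal_exp c n) `<=` M by exact: ideal_add_subr.
have sub_G : graded_kernel b q n.+1 `<=` G.
  rewrite /G graded_kernelS //; apply: ideal_add_subl.
  exact/is_ideal_scale/is_ideal_graded_kernel.
have e1 : ideal_exp c n `&` colon_elt G y = graded_kernel c q n.
  apply/seteqP; split=> x; first by move=> [_]; exact: graded_kernel_colon.
  move=> hx; split; first exact: graded_kernel_sub hx.
  rewrite /colon_elt /= /G graded_kernelS //; apply: ideal_add_subr.
    exact: is_ideal_graded_kernel.
  by exists x.
have MG : M `<=` ideal_add (graded_kernel b q n.+1) (ideal_scale y (ideal_exp c n)).
  have h := is_ideal_add (is_ideal_graded_kernel b q n.+1) hycn.
  apply: ideal_add_lub => //; last by apply: ideal_add_subr; exact: is_ideal_graded_kernel.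
  rewrite /G graded_kernelS //; apply: ideal_add_mono => // _ [k ck ->].
  by exists k => //; exact: graded_kernel_sub ck.
have e2 : ideal_exp b n.+1 `&` M = graded_kernel b q' n.+1.
  apply/seteqP; split=> x.
    move=> [bx /MG [w [_ [bw [v _ ->] ex]]]]; rewrite ex.
    by apply: graded_kernel_add_principal => //; rewrite -ex.
  move=> hx; split; first exact: graded_kernel_sub hx.
  have := graded_kernel_add_principal_sub hq hx; apply: ideal_add_lub => //.
    exact: subset_trans GM.
  move=> _ [k bk ->]; apply: yM; exists k => //.
  by apply: ideal_exp_mono bc _ _; exact: ideal_expS_sub bk.
have e3 : ideal_add M (ideal_exp b n.+1) = ideal_exp c n.+1.
  apply/seteqP; split.
    apply: ideal_add_lub; [exact: is_ideal_exp| |exact: ideal_exp_mono].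
    apply: ideal_add_lub; [exact: is_ideal_exp|exact: graded_kernel_sub|].
    by move=> _ [k ck ->]; exact: mem_mul.
  rewrite ideal_exp_add_principal //; apply: ideal_add_lub.
  - exact: is_ideal_add.
  - exact: ideal_add_subr.
  - by apply: subset_trans yM _; exact: ideal_add_subl.
have [E1 E1'] := rlen_scale y hG hcn; rewrite e1 -/M in E1 E1'.
have [E2 E2'] := rlen_second hM hbn; rewrite e2 e3 in E2 E2'.
have MC : M `<=` ideal_exp c n.+1 by rewrite -e3; exact: ideal_add_subl.
have [f ->] := rlen_add hG hM (is_ideal_exp c n.+1) GM MC (proj2 E1 f2) (proj2 E2 f1).
by split => //; rewrite E1' // E2' // addnC.
Qed.

End AddElement.

Lemma regular_ideal_graded k b : regular_ideal k b -> regular_on_graded b.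
Proof.
elim=> [|{}k {}b y hreg IH hy]; last first.
  by apply: regular_on_graded_add => //; exact: regular_ideal_ideal hreg.
move=> q z hq hz [|n] u; first by rewrite graded_kernel0 //; [move=> _; exact: hz|exact: is_ideal_zero].
by rewrite ideal_exp_zero => -> _; exact: (ideal0 (is_ideal_graded_kernel _ q n.+1)).
Qed.

Variable m : set R.
Hypothesis noethR : noetherian R.
Hypothesis localR : local_ring m.

(** The binomial coefficient counts the monomials of degree [n] in [k]
    variables; the truncated subtraction is right for [k = 0]. *)
Lemma rlen_graded k b : regular_ideal k b ->
  forall q, is_ideal q -> open_ideal m (ideal_add b q) -> forall n,
  finlen (graded_kernel b q n) (ideal_exp b n) /\
  rlen (graded_kernel b q n) (ideal_exp b n) =
    ('C((n + k).-1, n) * colength (ideal_add b q))%N.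
Proof.
elim=> [|{}k {}b y hreg IH hy] q hq oq.
  move=> [|n].
    rewrite graded_kernel0 //; last exact: is_ideal_zero.
    rewrite bin0 mul1n colength_rlen; split => //.
    exact: (open_finite_colength noethR localR oq).
  have -> : graded_kernel [set 0] q n.+1 = [set 0].
    apply/seteqP; split; last first.
      by move=> _ ->; exact: (ideal0 (is_ideal_graded_kernel _ q n.+1)).
    by rewrite -{2}(ideal_exp_zero R n); exact: graded_kernel_sub.
  rewrite ideal_exp_zero addn0 bin_small // mul0n rlen_refl; last exact: is_ideal_zero.
  by split => //; apply: finlen_refl; exact: is_ideal_zero.
have hb := regular_ideal_ideal hreg; have hg := regular_ideal_graded hreg.
have hc := is_ideal_add hb (is_ideal_principal y).
have hq' := is_ideal_add hq (is_ideal_principal y).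
elim=> [|n [f e]].
  rewrite graded_kernel0 // bin0 mul1n colength_rlen; split => //.
  exact: (open_finite_colength noethR localR oq).
have [|f' e'] := IH _ hq' _ n.+1; first by rewrite ideal_add_principalCA.
have [f'' ->] := rlen_gradedS hb hg hy hq f' f.
split => //; rewrite e e' ideal_add_principalCA // -mulnDl; congr (_ * _)%N.
by rewrite addnS addSn addnS /= binS.
Qed.

Lemma colength_regular_exp k c : regular_ideal k c -> open_ideal m c -> forall n,
  colength (ideal_exp c n.+1) = ('C(n + k, n) * colength c)%N.
Proof.
move=> hreg oc; have hc := regular_ideal_ideal hreg.
elim=> [|n IH]; first by rewrite ideal_exp1 // bin0 mul1n.
have e0 : ideal_add c [set 0] = c.
  by apply: ideal_addK => //; [exact: is_ideal_zero|move=> _ ->; exact: ideal0].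
have [|f e] := @rlen_graded k c hreg [set 0] (is_ideal_zero R) _ n.+1.
  by rewrite e0.
rewrite e0 graded_kernel_zero in f e.
have h1 := is_ideal_exp c n.+2; have h2 := is_ideal_exp c n.+1.
have f2 := open_finite_colength noethR localR (open_exp n.+1 oc).
have [_ e2] := rlen_add h1 h2 (@is_idealT R) (@ideal_expS_sub R c n.+1) (@subsetT _ _) f f2.
rewrite colength_rlen e2 e -colength_rlen IH -mulnDl.
by rewrite addSn /= binS.
Qed.

End RegularPowers.

(** * Graded families of ideals *)

Section GradedFamilies.
Variable R : comNzRingType.
Implicit Types (I J K b c : set R) (x y z : R) (B C : nat -> set R).

(** A homogeneous ideal of the Rees algebra of [c], as the family of its
    homogeneous parts. *)
Definition graded_family c B : Prop :=
  [/\ forall n, is_ideal (B n), forall n, B n `<=` ideal_exp c n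
    & forall n x z, c x -> B n z -> B n.+1 (x * z)].

Definition family_acc c : Prop := forall F : nat -> nat -> set R,
  (forall k, graded_family c (F k)) -> (forall k n, F k n `<=` F k.+1 n) ->
  exists k0, forall k, (k0 <= k)%N -> F k = F k0.

Lemma family_le (F : nat -> nat -> set R) i j n :
  (forall k n, F k n `<=` F k.+1 n) -> (i <= j)%N -> F i n `<=` F j n.
Proof. by move=> hF h; apply: (@ideal_chain_le R (F^~ n) i j _ h) => k; exact: hF. Qed.

(** For each [j] the sequence [F k j] has a limit. These limits increase with
    [j], hence are constant from some [j0] on; this settles all [j >= j0] at
    once, and the finitely many others are settled one by one. *)
Lemma family_acc_double c (F : nat -> nat -> nat -> set R) :
  family_acc c -> (forall k j, graded_family c (F k j)) ->
  (forall k j n, F k j n `<=` F k.+1 j n) ->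
  (forall k j n, F k j n `<=` F k j.+1 n) ->
  exists k0, forall k, (k0 <= k)%N -> forall j, F k j = F k0 j.
Proof.
move=> acc gF inck incj.
have [K hK] := choice (fun j => acc (F^~ j) (gF^~ j) (fun k n => inck k j n)).
have lek k k' j n : (k <= k')%N -> F k j n `<=` F k' j n.
  by move=> h; apply: (@family_le (F^~ j) k k' n _ h) => ? ?; exact: inck.
have lej k j j' n : (j <= j')%N -> F k j n `<=` F k j' n.
  by move=> h; apply: (@family_le (F k) j j' n _ h) => ? ?; exact: incj.
have [j0 hj0] : exists j0, forall j, (j0 <= j)%N -> F (K j) j = F (K j0) j0.
  apply: (acc (fun j => F (K j) j)) => // j n.
  have h := leq_maxl (K j) (K j.+1); have h' := leq_maxr (K j) (K j.+1).
  by rewrite -(hK j _ h) -(hK j.+1 _ h'); exact: incj.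
have limit k j : (j0 <= j)%N -> (K j0 <= k)%N -> F k j = F (K j0) j0.
  move=> hj hk; apply: funext => n; apply/seteqP; split.
    rewrite -(hj0 j hj) -(hK j _ (leq_maxr k (K j))).
    by apply: lek; exact: leq_maxl.
  by rewrite -(hK j0 k hk); exact: lej.
pose k0 := (\max_(j < j0.+1) K j)%N.
have hk0 j : (j <= j0)%N -> (K j <= k0)%N.
  by move=> hj; exact: (leq_bigmax (F := fun i : 'I_j0.+1 => K i) (Ordinal (hj : (j < j0.+1)%N))).
exists k0 => k hk j; case: (leqP j j0) => hj.
  by rewrite hK; [rewrite hK //; exact: hk0|exact: leq_trans (hk0 j hj) hk].
by rewrite !limit //; try exact: ltnW; [exact: hk0|exact: leq_trans (hk0 _ _) hk].
Qed.

Section AddElement.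
Variables (b : set R) (y : R).
Hypothesis hb : is_ideal b.
Let c := ideal_add b (principal y).

Let hc : is_ideal c.
Proof. by apply: is_ideal_add => //; exact: is_ideal_principal. Qed.
Let bc : b `<=` c.
Proof. by apply: ideal_add_subl; exact: is_ideal_principal. Qed.
Let cy : c y. Proof. exact: ideal_add_principal_gen. Qed.

(** The degree [n] part of the ideal of the Rees algebra generated by [y] as an
    element of degree one. *)
Definition divisible_part n : set R :=
  if n is n'.+1 then ideal_scale y (ideal_exp c n') else [set 0].

(** Leading coefficients, as in the proof of Hilbert's basis theorem. *)
Definition lead B n : set R :=
  ideal_exp b n `&` ideal_add (B n) (divisible_part n).

(** The colon ideal of [B] by [y] as an element of degree one. *)
Definition shift B n : set R := ideal_exp c n `&` colon_elt (B n.+1) y.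

Lemma is_ideal_divisible_part n : is_ideal (divisible_part n).
Proof. by case: n => [|n]; [exact: is_ideal_zero|exact/is_ideal_scale/is_ideal_exp]. Qed.

Lemma ideal_exp_divisible n :
  ideal_exp c n = ideal_add (ideal_exp b n) (divisible_part n).
Proof.
case: n => [|n]; last exact: ideal_exp_add_principal.
apply/seteqP; split => // x _; apply: ideal_add_subl => //; exact: is_ideal_zero.
Qed.

Lemma lead_family B : graded_family c B -> graded_family b (lead B).
Proof.
move=> [h1 h2 h3]; split => n.
- apply: is_ideal_cap; first exact: is_ideal_exp.
  by apply: is_ideal_add => //; exact: is_ideal_divisible_part.
- exact: subIsetl.
- move=> x z bx [bz [w [v [Bw Vv ezwv]]]]; split; first exact: mem_mul.
  rewrite ezwv mulrDr; exists (x * w), (x * v); split => //.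
    by apply: h3 => //; exact: bc.
  case: n Vv {bz Bw ezwv} => [|n]; first by move=> ->; exists 0; rewrite ?mulr0.
  move=> [k ck ->]; exists (x * k); last by rewrite mulrCA.
  by apply: mem_mul => //; exact: bc.
Qed.

Lemma shift_family B : graded_family c B -> graded_family c (shift B).
Proof.
move=> [h1 h2 h3]; split => n.
- by apply: is_ideal_cap; [exact: is_ideal_exp|exact: is_ideal_colon_elt].
- exact: subIsetl.
- move=> x z cx [cz Bz]; split; first exact: mem_mul.
  by rewrite /colon_elt /= mulrCA; exact: h3.
Qed.

Lemma iter_shift_family B j : graded_family c B -> graded_family c (iter j shift B).
Proof. by move=> hB; elim: j => [//|j IH]; exact: shift_family. Qed.

Lemma sub_shift B n : graded_family c B -> B n `<=` shift B n.
Proof. by move=> [h1 h2 h3] z Bz; split; [exact: h2|exact: h3]. Qed.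

Lemma lead_mono B C n : B n `<=` C n -> lead B n `<=` lead C n.
Proof. by move=> h; apply: setIS; exact: ideal_add_mono. Qed.

Lemma shift_mono B C : (forall n, B n `<=` C n) -> forall n, shift B n `<=` shift C n.
Proof. by move=> h n; apply: setIS => x; exact: h. Qed.

Lemma iter_shift_mono B C j : (forall n, B n `<=` C n) ->
  forall n, iter j shift B n `<=` iter j shift C n.
Proof. by move=> h; elim: j => [//|j IH] n; exact: shift_mono. Qed.

(** A family is determined by the leading coefficients of its shifts: modulo
    the leading coefficients, elements are divisible by [y], and the quotient
    lies in the shift, one degree lower. *)
Lemma family_determined B C n : graded_family c B -> graded_family c C ->
  (forall k, B k `<=` C k) ->
  (forall j k, lead (iter j shift C) k `<=` lead (iter j shift B) k) ->
  C n `<=` B n.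
Proof.
elim: n B C => [|n IH] B C gB gC BC hl z Cz;
  have [hB B2 B3] := gB; have [hC C2 C3] := gC; have := C2 _ z Cz;
  rewrite ideal_exp_divisible => -[r [v [br Vv ezrv]]].
  have : lead C 0 r.
    by split => //; exists z, 0; split => //; rewrite ezrv (Vv : v = 0) !addr0.
  move=> /(hl 0%N) [_ [w [_ [Bw -> er]]]].
  by rewrite ezrv er (Vv : v = 0) !addr0.
have : lead C n.+1 r.
  split => //; exists z, (- v); split => //; last by rewrite ezrv addrK.
  by apply: idealN => //; exact: (is_ideal_divisible_part n.+1).
move=> /(hl 0%N) [_ [w [v' [Bw Vv' er]]]].
have [k ck ekv] : divisible_part n.+1 (v' + v).
  by apply: idealD => //; exact: (is_ideal_divisible_part n.+1).
have ez : z = w + y * k by rewrite ezrv er -addrA ekv.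
rewrite ez; apply: idealD => //.
suff h : shift C n `<=` shift B n.
  have [|_ //] := h k; split => //; apply: (ideal_addl_cancel (hC n.+1) (BC _ _ Bw)).
  by rewrite -ez.
apply: IH; try exact: shift_family; first exact: shift_mono.
by move=> j i; rewrite -!iterSr; exact: hl.
Qed.

Lemma family_acc_add : family_acc b -> family_acc c.
Proof.
move=> acc F gF incF.
have [|||k0 hk0] := @family_acc_double b (fun k j => lead (iter j shift (F k))) acc.
- by move=> k j; apply: lead_family; exact: iter_shift_family.
- by move=> k j n; apply: lead_mono; apply: iter_shift_mono => i; exact: incF.
- move=> k j n; apply: lead_mono; rewrite iterS; apply: sub_shift.
  exact: iter_shift_family.
exists k0 => k hk; apply: funext => n.
have le i : F k0 i `<=` F k i by exact: family_le.
apply/seteqP; split; last exact: le.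
by apply: family_determined => // j i; rewrite -(hk0 k hk j).
Qed.

End AddElement.

Hypothesis noethR : noetherian R.

(** In other words, the Rees algebra of [c] is Noetherian. *)
Lemma rees_noetherian c : is_ideal c -> family_acc c.
Proof.
move: c; apply: (ideal_fg_ind noethR); last by move=> b y hb; exact: family_acc_add.
move=> F gF incF.
have [||k0 hk0] := @ideal_acc R noethR (F^~ 0%N).
- by move=> k; case: (gF k).
- by move=> k; exact: incF.
exists k0 => k hk; apply: funext => -[|n]; first exact: hk0.
have z k' : F k' n.+1 = [set 0].
  have [h1 h2 _] := gF k'; apply/seteqP; split.
    by rewrite -(ideal_exp_zero R n); exact: h2.
  by move=> _ ->; exact: ideal0.
by rewrite !z.
Qed.

(** The families [n |-> c^n `&` (I + x c^(n-k))] increase with [k], and the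
    one with [k = n] is [c^n `&` (I + (x))] in degree [n]. *)
Lemma artin_rees c I x : is_ideal c -> is_ideal I ->
  exists k0, forall n z, (k0 <= n)%N -> ideal_exp c n z ->
    ideal_add I (principal x) z ->
    ideal_add I (ideal_scale x (ideal_exp c (n - k0))) z.
Proof.
move=> hc hI.
pose F k n := ideal_exp c n `&` ideal_add I (ideal_scale x (ideal_exp c (n - k))).
have [|k n|k0 hk0] := rees_noetherian hc (F := F).
- move=> k; split=> n.
  + apply: is_ideal_cap; first exact: is_ideal_exp.
    by apply: is_ideal_add => //; exact/is_ideal_scale/is_ideal_exp.
  + exact: subIsetl.
  + move=> u z cu [cz [w [_ [Iw [t ct ->] ezw]]]]; split; first exact: mem_mul.
    rewrite ezw mulrDr mulrCA; exists (u * w), (x * (u * t)); split => //.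
      exact: idealMl.
    exists (u * t) => //; apply: (@ideal_exp_le _ c _ (n - k).+1); first by lia.
    exact: mem_mul.
- apply: setIS; apply: ideal_add_mono => // _ [t ct ->]; exists t => //.
  by apply: ideal_exp_le ct; lia.
exists k0 => n z hn cz Iz.
suff : F k0 n z by case.
by rewrite -(hk0 n hn); split => //; rewrite subnn.
Qed.

End GradedFamilies.
(** * Hilbert functions are eventually polynomial *)

Section EventuallyPolynomial.
Implicit Types (p q : {poly rat}) (g h : nat -> nat).

Definition eventually_poly h : Prop :=
  exists p N, forall n, (N <= n)%N -> (h n)%:R = p.[n%:R] :> rat.

Definition falling_poly k : {poly rat} := \prod_(i < k) ('X - (i%:R)%:P).

Lemma falling_polyS k : falling_poly k.+1 = falling_poly k * ('X - (k%:R)%:P).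
Proof. by rewrite /falling_poly big_ord_recr. Qed.

Lemma falling_polyS_shift k (x : rat) :
  (falling_poly k.+1).[x + 1] = (x + 1) * (falling_poly k).[x].
Proof.
elim: k x => [|k IH] x.
  by rewrite falling_polyS /falling_poly !big_ord0 !hornerE; ring.
by rewrite falling_polyS hornerM IH falling_polyS hornerM !hornerXsubC -natr1; ring.
Qed.

Lemma falling_poly_diff k (x : rat) :
  (falling_poly k.+1).[x + 1] - (falling_poly k.+1).[x]
    = k.+1%:R * (falling_poly k).[x].
Proof.
by rewrite falling_polyS_shift falling_polyS hornerM hornerXsubC -natr1; ring.
Qed.

Lemma size_falling_poly k : size (falling_poly k) = k.+1.
Proof.
by rewrite /falling_poly size_prod_XsubC /index_enum -enumT size_enum_ord.
Qed.

Lemma coef_falling_poly k : (falling_poly k)`_k = 1.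
Proof.
have /monicP : falling_poly k \is monic by exact: monic_prod_XsubC.
by rewrite lead_coefE size_falling_poly.
Qed.

(** Falling factorials form a basis on which taking antidifferences is, up to
    a scalar, a shift of the index. *)
Lemma poly_antidifference p :
  exists q, forall x : rat, q.[x + 1] - q.[x] = p.[x].
Proof.
have [k hk] : exists k, (size p <= k)%N by exists (size p).
elim: k p hk => [|k IH] p hk.
  exists 0 => x; move: hk; rewrite leqn0 size_poly_eq0 => /eqP ->.
  by rewrite !horner0 subr0.
have [|q hq] := IH (p - p`_k *: falling_poly k).
  apply/leq_sizeP => j; rewrite leq_eqVlt => /orP[/eqP <-|hj].
    by rewrite coefB coefZ coef_falling_poly mulr1 subrr.
  have e1 : p`_j = 0 by apply: nth_default; exact: leq_trans hk hj.
  have e2 : (falling_poly k)`_j = 0 by apply: nth_default; rewrite size_falling_poly.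
  by rewrite coefB coefZ e1 e2 mulr0 subr0.
exists (q + (p`_k / k.+1%:R) *: falling_poly k.+1) => x.
rewrite !hornerD !hornerZ.
have -> : forall u v s t w : rat, u + w * s - (v + w * t) = (u - v) + w * (s - t).
  by move=> *; ring.
rewrite hq falling_poly_diff hornerD hornerN hornerZ.
have hk0 : k.+1%:R != 0 :> rat by rewrite Num.Theory.pnatr_eq0.
by rewrite mulrA divfK // subrK.
Qed.

Lemma eventually_poly_sum g h :
  eventually_poly g -> (forall n, h n.+1 = (g n.+1 + h n)%N) -> eventually_poly h.
Proof.
move=> [p [N hp]] hh; have [q hq] := poly_antidifference p.
exists (q \Po ('X + 1%:P) + ((h N)%:R - q.[N%:R + 1])%:P), N => n /subnK <-.
elim: (n - N)%N => [|k IH].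
  by rewrite add0n !(hornerD, hornerC, hornerX, horner_comp); ring.
rewrite addSn hh natrD IH hp; last by lia.
rewrite !(hornerD, hornerC, hornerX, horner_comp) -hq -natr1.
by ring.
Qed.

Lemma eventually_poly_shift_add g h h' :
  eventually_poly g -> eventually_poly h' ->
  (forall n, h n.+1 = (g n.+1 + h' n)%N) -> eventually_poly h.
Proof.
move=> [p [N hp]] [q [N' hq]] hh.
exists (p + (q \Po ('X - 1%:P))), (maxn N N').+1 => -[//|n] hn.
rewrite hh natrD hp ?hq; try by lia.
have e : n.+1%:R - 1 = n%:R :> rat by rewrite -natr1 addrK.
by rewrite !(hornerD, hornerN, hornerC, hornerX, horner_comp) e.
Qed.

End EventuallyPolynomial.

Section HilbertFunction.
Variable R : comNzRingType.
Hypothesis noethR : noetherian R.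
Implicit Types (b c : set R) (y : R) (B : nat -> set R).

Definition polynomial_lengths c : Prop := forall B,
  graded_family c B -> (forall n, finlen (B n) (ideal_exp c n)) ->
  eventually_poly (fun n => rlen (B n) (ideal_exp c n)).

Section AddElement.
Variables (b : set R) (y : R) (B : nat -> set R).
Hypothesis hb : is_ideal b.
Let c := ideal_add b (principal y).
Hypothesis gB : graded_family c B.
Hypothesis fB : forall n, finlen (B n) (ideal_exp c n).

(** Filter [c^(n+1) / B (n+1)] by the image of [y c^n]. *)
Lemma rlen_lead_shift n :
  [/\ finlen (lead b y B n.+1) (ideal_exp b n.+1),
      finlen (shift b y B n) (ideal_exp c n)
    & rlen (B n.+1) (ideal_exp c n.+1) =
      (rlen (lead b y B n.+1) (ideal_exp b n.+1)
       + rlen (shift b y B n) (ideal_exp c n))%N].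
Proof.
have [B1 B2 B3] := gB; have cy : c y by exact: ideal_add_principal_gen.
have hcn := is_ideal_exp c n; have hcn1 := is_ideal_exp c n.+1.
have hbn := is_ideal_exp b n.+1.
have hBn := B1 n.+1; have hycn := is_ideal_scale y hcn.
set M := ideal_add (B n.+1) (ideal_scale y (ideal_exp c n)).
have hM : is_ideal M by exact: is_ideal_add.
have BM : B n.+1 `<=` M by exact: ideal_add_subl.
have yM : ideal_scale y (ideal_exp c n) `<=` M by exact: ideal_add_subr.
have e3 : ideal_add M (ideal_exp b n.+1) = ideal_exp c n.+1.
  have bc : b `<=` c by apply: ideal_add_subl; exact: is_ideal_principal.
  apply/seteqP; split.
    apply: ideal_add_lub => //; last exact: ideal_exp_mono.
    by apply: ideal_add_lub => // _ [k ck ->]; exact: mem_mul.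
  rewrite ideal_exp_add_principal //; apply: ideal_add_lub.
  - exact: is_ideal_add.
  - exact: ideal_add_subr.
  - by apply: subset_trans yM _; exact: ideal_add_subl.
have MC : M `<=` ideal_exp c n.+1 by rewrite -e3; exact: ideal_add_subl.
have [f1 _] := rlen_sub hBn BM (@subset_refl _ _) MC (fB n.+1).
have [f2 _] := rlen_sub hM MC BM (@subset_refl _ _) (fB n.+1).
have [E1 E1'] := rlen_scale y hBn hcn; rewrite -/M in E1 E1'.
have [E2 E2'] := rlen_second hM hbn; rewrite e3 in E2 E2'.
have [_ ->] := rlen_add hBn hM hcn1 BM MC f1 f2.
move: f1 f2 => /E1 f1 /E2 f2.
by split => //; rewrite E1' // E2' // addnC.
Qed.

Lemma lead_finlen n : finlen (lead b y B n) (ideal_exp b n).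
Proof.
case: n => [|n]; last by case: (rlen_lead_shift n).
have [B1 _ _] := gB.
have -> : lead b y B 0 = B 0%N; last exact: fB.
rewrite /lead setTI; apply: (ideal_addK (is_ideal_zero R) (B1 0%N)).
by move=> _ ->; exact: (ideal0 (B1 0%N)).
Qed.

End AddElement.

(** Iterated shifts of [B] become constant. For a family equal to its shift the
    differences of the length function are those of the leading
    coefficients, a family for [b]; the earlier shifts follow by descending
    induction. *)
Lemma polynomial_lengths_add b y : is_ideal b ->
  polynomial_lengths b -> polynomial_lengths (ideal_add b (principal y)).
Proof.
move=> hb polb B gB fB; set c := ideal_add b (principal y).
have hc : is_ideal c by apply: is_ideal_add => //; exact: is_ideal_principal.
pose S j := iter j (shift b y) B.
have gS j : graded_family c (S j) by exact: iter_shift_family.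
have fS j n : finlen (S j n) (ideal_exp c n).
  elim: j n => [//|j IH] n.
  by have [_ + _] := rlen_lead_shift hb (gS j) (IH) n.
have leadP j : eventually_poly (fun n => rlen (lead b y (S j) n) (ideal_exp b n)).
  by apply: polb; [exact: lead_family|move=> n; exact: lead_finlen].
have stepP j n : rlen (S j n.+1) (ideal_exp c n.+1) =
    (rlen (lead b y (S j) n.+1) (ideal_exp b n.+1)
     + rlen (S j.+1 n) (ideal_exp c n))%N.
  by have [_ _ ->] := rlen_lead_shift hb (gS j) (fS j) n.
have [||j0 hj0] := rees_noetherian noethR hc (F := S).
- exact: gS.
- by move=> j n; exact: (sub_shift hb (gS j)).
suff h i : eventually_poly (fun n => rlen (S (j0 - i)%N n) (ideal_exp c n)).
  by have := h j0; rewrite subnn.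
elim: i => [|i IH].
  rewrite subn0; apply: (eventually_poly_sum (leadP j0)) => n.
  by rewrite stepP (hj0 j0.+1).
case: (ltnP i j0) => hi; last first.
  by move: IH; have -> : (j0 - i = j0 - i.+1)%N by lia.
apply: (eventually_poly_shift_add (leadP (j0 - i.+1)%N) IH) => n.
by rewrite stepP; have -> : (j0 - i.+1).+1 = (j0 - i)%N by lia.
Qed.

Lemma polynomial_lengths_ideal c : is_ideal c -> polynomial_lengths c.
Proof.
move: c; apply: (ideal_fg_ind noethR); last by move=> b y; exact: polynomial_lengths_add.
move=> B [h1 h2 _] fB; exists 0, 1%N => -[//|n] _.
have -> : B n.+1 = [set 0].
  apply/seteqP; split; first by rewrite -(ideal_exp_zero R n); exact: h2.
  by move=> _ ->; exact: (ideal0 (h1 _)).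
by rewrite ideal_exp_zero rlen_refl ?horner0 //; exact: is_ideal_zero.
Qed.

Variable m : set R.
Hypothesis localR : local_ring m.

Lemma hilbert_samuel_exists a : open_ideal m a ->
  exists p, is_hilbert_samuel_poly a p.
Proof.
move=> oa; have ha : is_ideal a by case: oa.
have fin n : finite_colength (ideal_exp a n).
  exact: (open_finite_colength noethR localR (open_exp n oa)).
have sub n : ideal_exp a n.+1 `<=` ideal_exp a n := @ideal_expS_sub R a n.
have hn n := is_ideal_exp a n.
have f n : finlen (ideal_exp a n.+1) (ideal_exp a n).
  by have [] := rlen_sub (hn n.+1) (sub n) (@subset_refl _ _) (@subsetT _ _) (fin n.+1).
have gr : eventually_poly (fun n => rlen (ideal_exp a n.+1) (ideal_exp a n)).
  apply: (polynomial_lengths_ideal ha (B := fun n => ideal_exp a n.+1)) => //.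
  split=> n; [exact: hn|exact: sub|by move=> x z ax az; exact: mem_mul].
have [|p [N hp]] := eventually_poly_sum (h := fun n => colength (ideal_exp a n.+1)) gr.
  move=> n; rewrite !colength_rlen.
  by have [_ ->] := rlen_add (hn n.+2) (hn n.+1) (@is_idealT R) (sub _) (@subsetT _ _) (f _) (fin _).
exists (p \Po ('X - 1%:P)), N.+1 => -[//|n] hN.
by rewrite hp // !(hornerD, hornerN, hornerC, hornerX, horner_comp) -natr1 addrK.
Qed.

End HilbertFunction.

(** * Krull dimension *)

Section KrullDimension.
Variables (R : comNzRingType) (m : set R).
Hypothesis noethR : noetherian R.
Hypothesis localR : local_ring m.
Implicit Types (I P Q b : set R) (x y z : R).

(** Below a prime containing [b + (y)] with [y] regular modulo [b] there is a
    smaller prime containing [b]: avoid the products of powers of [y] with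
    elements outside the given prime. *)
Lemma prime_chain_below k b : regular_ideal k b ->
  forall P, prime_ideal P -> b `<=` P ->
  exists F, chain (@prime_ideal R) F k /\ F k = P.
Proof.
elim=> [|{}k {}b y hreg IH hy] P pP bP.
  by exists (fun=> P); split => //; exact: chain_const.
have hb := regular_ideal_ideal hreg; have [[hP nP1] P_prime] := pP.
have Py : P y by apply: bP; exact: ideal_add_principal_gen.
have bP' : b `<=` P.
  by apply: subset_trans bP; apply: ideal_add_subl; exact: is_ideal_principal.
pose S z := exists s j, ~ P s /\ z = s * y ^+ j.
have regj j s : b (y ^+ j * s) -> b s.
  by elim: j => [|j IHj]; [rewrite mul1r|rewrite exprS -mulrA => /hy].
have [|||Q [pQ bQ dQ]] := @prime_avoiding R noethR S _ _ b hb.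
- by exists 1, 0%N; rewrite mulr1.
- move=> _ _ [s [i [nPs ->]]] [t [j [nPt ->]]]; exists (s * t), (i + j)%N.
  by split; [case/P_prime|rewrite exprD mulrACA].
- move=> z + [s [j [nPs ez]]]; rewrite ez mulrC => /regj bs; exact/nPs/bP'.
have [F [cF Fk]] := IH Q pQ bQ.
exists (fun i => if (i <= k)%N then F i else P); rewrite ltnn; split => //.
apply: chain_rcons => //; rewrite Fk; split.
  move=> z Qz; apply: contrapT => nPz; apply: (dQ z Qz).
  by exists z, 0%N; rewrite mulr1.
by move=> /(_ y Py) Qy; apply: (dQ y Qy); exists 1, 1%N; rewrite mul1r.
Qed.

Variables (dim : nat) (c : set R).
Hypothesis regc : regular_ideal dim c.
Hypothesis openc : open_ideal m c.
Hypothesis properc : ~ c 1.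

Let hc : is_ideal c. Proof. by case: openc. Qed.

Definition hilbert_function P n : nat := colength (ideal_add P (ideal_exp c n)).

Lemma open_add_exp P n : is_ideal P -> open_ideal m (ideal_add P (ideal_exp c n)).
Proof.
move=> hP; have hn := is_ideal_exp c n.
apply: (open_sub (open_exp n openc)); first exact: is_ideal_add.
exact: ideal_add_subr.
Qed.

Lemma colength_antitone I J : open_ideal m I -> is_ideal J -> I `<=` J ->
  (colength J <= colength I)%N.
Proof.
move=> oI hJ IJ.
by have [] := colength_le hJ IJ (open_finite_colength noethR localR oI).
Qed.

Lemma hilbert_function_le P n k : is_ideal P -> (n <= k)%N ->
  (hilbert_function P n <= hilbert_function P k)%N.
Proof.
move=> hP hnk; apply: colength_antitone; first exact: open_add_exp.
  by apply: is_ideal_add => //; exact: is_ideal_exp.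
by apply: ideal_add_mono => //; exact: ideal_exp_le.
Qed.

(** Multiplication by [x] on the domain [R / P] raises the [c]-adic order by
    a bounded amount only, by the Artin-Rees lemma. *)
Lemma hilbert_function_quotient P Q x : prime_ideal P -> is_ideal Q ->
  P `<=` Q -> Q x -> ~ P x ->
  exists k0, forall n, (k0 <= n)%N ->
    (hilbert_function Q n + hilbert_function P (n - k0) <= hilbert_function P n)%N.
Proof.
move=> [[hP nP1] P_prime] hQ PQ Qx nPx.
have [k0 AR] := artin_rees noethR x hc hP; exists k0 => n hn.
have hcn := is_ideal_exp c n; have hck := is_ideal_exp c (n - k0)%N.
set I := ideal_add P (ideal_exp c n).
have hI : is_ideal I by exact: is_ideal_add.
have oI : open_ideal m I by exact: open_add_exp.
have colI : colon_elt I x `<=` ideal_add P (ideal_exp c (n - k0)).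
  move=> r [p [z [Pp cz exr]]].
  have [|p' [_ [Pp' [t ct ->] ez]]] := AR n z hn cz.
    exists (- p), (x * r); split; [exact: idealN|exact: mem_principal|].
    by rewrite exr addrA addNr add0r.
  have : P (x * (r - t)).
    by rewrite mulrBr exr ez addrA addrK; exact: idealD.
  move=> /P_prime [//|Prt]; exists (r - t), t; split => //.
  by rewrite subrK.
have sumI : ideal_add I (principal x) `<=` ideal_add Q (ideal_exp c n).
  apply: ideal_add_lub; first exact: is_ideal_add.
    exact: ideal_add_mono.
  by apply: subset_trans (principal_sub hQ Qx) _; exact: ideal_add_subl.
have hcol := is_ideal_colon_elt x hI.
have hsum := is_ideal_add hI (is_ideal_principal x).
have Icol : I `<=` colon_elt I x by move=> r Ir; exact: idealMl.
have Isum : I `<=` ideal_add I (principal x).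
  by apply: ideal_add_subl; exact: is_ideal_principal.
have ocol := open_sub oI hcol Icol; have osum := open_sub oI hsum Isum.
have [_ e] := colength_colon hI (open_finite_colength noethR localR ocol)
  (open_finite_colength noethR localR osum).
rewrite -[X in (_ <= X)%N]/(colength I) e addnC; apply: leq_add.
  by apply: colength_antitone => //; exact: is_ideal_add.
by apply: colength_antitone => //; exact: is_ideal_add.
Qed.

Lemma hilbert_function_gt0 P n : prime_ideal P -> (0 < n)%N ->
  (0 < hilbert_function P n)%N.
Proof.
move=> [[hP nP1] _]; case: n => [//|n] _.
apply: (colength_proper_gt0 noethR localR); first exact: open_add_exp.
have mm := maximal_is_ideal localR.
suff h : ideal_add P (ideal_exp c n.+1) `<=` m by move=> /h; exact: maximal_not1 localR.
apply: ideal_add_lub => //; first exact: (proper_sub_maximal noethR localR).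
apply: (@subset_trans _ c); first exact: ideal_mul_subl.
exact: (proper_sub_maximal noethR localR).
Qed.

(** Each step of a chain of primes costs one degree of growth: adding up
    [n] instances of the previous inequality gives
    [n * hilbert_function Q n <= hilbert_function P (n + n * k0)]. *)
Lemma prime_chain_growth l k C F :
  chain (@prime_ideal R) F l ->
  (forall n, (0 < n)%N -> (hilbert_function (F 0%N) n <= C * n ^ k)%N) ->
  (l <= k)%N.
Proof.
elim: l k C F => [//|l IH] k C F [hF1 hF2] growth.
have pP := hF1 0%N isT; have pQ := hF1 1%N isT.
have hP : is_ideal (F 0%N) by case: pP => -[].
have hQ : is_ideal (F 1%N) by case: pQ => -[].
have [PQ nQP] := hF2 0%N isT.
have [x [Qx nPx]] : exists x, F 1%N x /\ ~ F 0%N x.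
  apply: contrapT => h; apply: nQP => x Qx; apply: contrapT => nPx.
  by apply: h; exists x.
have [k0 step] := hilbert_function_quotient pP hQ PQ Qx nPx.
have sum n i : (i * hilbert_function (F 1%N) n <= hilbert_function (F 0%N) (n + i * k0))%N.
  elim: i => [//|i IHi].
  have := step (n + i.+1 * k0)%N; rewrite mulSn addnCA addKn => h.
  apply: leq_trans (h _); last exact: leq_addr.
  by rewrite mulSn; apply: leq_add => //; apply: hilbert_function_le => //; lia.
have bound n : (0 < n)%N ->
    (n * hilbert_function (F 1%N) n <= C * (k0.+1 ^ k) * n ^ k)%N.
  move=> hn; apply: leq_trans (sum n n) _.
  rewrite -mulnS mulnC -mulnA -expnMn; apply: growth.
  by rewrite muln_gt0.
case: k growth bound => [|k] growth bound.
  have := bound C.+1 isT; rewrite !expn0 !muln1.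
  have := hilbert_function_gt0 pQ (ltn0Sn C); nia.
rewrite ltnS; apply: (IH k (C * k0.+1 ^ k.+1)%N (fun i => F i.+1)).
  by split=> i hi; [exact: hF1|exact: hF2].
move=> n hn; have := bound n hn.
by rewrite (expnS n) mulnCA leq_pmul2l.
Qed.

Lemma bin_le_exp n k : ('C(n + k, k) <= n.+1 ^ k)%N.
Proof.
elim: k => [|k IH]; first by rewrite bin0.
rewrite -(leq_pmul2l (ltn0Sn k)).
have := mul_bin_diag (n + k.+1) k; rewrite addnS /= => <-.
apply: (@leq_trans ((n + k).+1 * n.+1 ^ k)%N); first by rewrite leq_mul2l IH orbT.
by rewrite expnS mulnA leq_mul2r; apply/orP; right; nia.
Qed.

Lemma krull_dim_regular : krull_dim R = dim.
Proof.
have lower : exists F, chain (@prime_ideal R) F dim.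
  have [|||Q [pQ cQ _]] := @prime_avoiding R noethR [set 1] _ _ c hc.
  - by [].
  - by move=> _ _ -> ->; rewrite /= mulr1.
  - by move=> x cx x1; apply: properc; rewrite -[1]/(1 : R) -(x1 : x = 1).
  by have [F [cF _]] := prime_chain_below regc pQ cQ; exists F.
have upper l : (exists F, chain (@prime_ideal R) F l) -> (l <= dim)%N.
  move=> [F cF]; apply: (prime_chain_growth (C := colength c) cF) => -[//|n] _.
  have hF : is_ideal (F 0%N) by have [[[]]] := (proj1 cF) 0%N isT.
  have hn := is_ideal_exp c n.+1.
  apply: (@leq_trans (colength (ideal_exp c n.+1))).
    apply: colength_antitone; first exact: open_exp.
      exact: is_ideal_add.
    exact: ideal_add_subr.
  rewrite (colength_regular_exp noethR localR regc openc) mulnC leq_mul2l.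
  by rewrite -bin_sub ?leq_addr // addKn bin_le_exp orbT.
have [] := @max_lengthP [set l | exists F, chain (@prime_ideal R) F l] dim.
- by exists dim.
- exact: upper.
- move=> h1 h2; apply/eqP; rewrite eqn_leq /krull_dim; apply/andP; split.
    exact: upper.
  exact: h2.
Qed.

End KrullDimension.

(** * Multiplicities *)

Section PolynomialGrowth.
Import Order.TTheory Num.Theory.
Implicit Types p q : {poly rat}.

(** The monic multiple of [p] is positive at large arguments. *)
Lemma lead_coef_ge0 p N :
  (forall n : nat, (N <= n)%N -> 0 <= p.[n%:R]) -> 0 <= lead_coef p.
Proof.
move=> hp; have [->|p0] := eqVneq p 0; first by rewrite lead_coef0.
have l0 : lead_coef p != 0 by rewrite lead_coef_eq0.
rewrite leNgt; apply/negP => lneg.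
have mon : (lead_coef p)^-1 *: p \is monic.
  by rewrite monicE lead_coefZ mulVf.
have [x hx] := monic_Cauchy_bound mon.
pose n := maxn N (Num.bound `|x|).
have hn : x <= n%:R.
  apply: (@le_trans _ _ (Num.bound `|x|)%:R); last by rewrite ler_nat leq_maxr.
  by apply: le_trans (ler_norm x) _; exact: (ltW (archi_boundP (normr_ge0 x))).
have := hx n%:R hn; rewrite hornerZ => h.
have := hp n (leq_maxl _ _); rewrite leNgt => /negP; apply.
have linv : (lead_coef p)^-1 < 0 by rewrite invr_lt0.
by rewrite -(nmulr_rgt0 _ linv).
Qed.

(** Both [p] and [q - p] have a nonnegative leading coefficient, and these
    would be opposite if the degree of [p] exceeded that of [q]. *)
Lemma coef_squeeze p q r N :
  (size q <= r)%N -> (forall n : nat, (N <= n)%N -> 0 <= p.[n%:R] <= q.[n%:R]) ->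
  p`_r = 0.
Proof.
move=> hq hpq; apply: nth_default; rewrite leqNgt; apply/negP => hr.
have l1 : 0 <= lead_coef p by apply: (@lead_coef_ge0 p N) => n /hpq /andP[].
have l2 : 0 <= lead_coef (q - p).
  apply: (@lead_coef_ge0 _ N) => n /hpq /andP[_ h].
  by rewrite hornerD hornerN subr_ge0.
move: l2; rewrite lead_coefDr ?size_polyN ?(leq_ltn_trans hq hr) // lead_coefN oppr_ge0 => l2.
have : lead_coef p == 0 by rewrite eq_le l2.
by rewrite lead_coef_eq0 => /eqP p0; rewrite p0 size_poly0 in hr.
Qed.

(** Rising factorials, with value [n (n+1) ... (n+k-1)] at [n]. *)
Definition rising_poly k : {poly rat} := \prod_(i < k) ('X - (- i%:R)%:P).

Lemma size_rising_poly k : size (rising_poly k) = k.+1.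
Proof. by rewrite /rising_poly size_prod_XsubC /index_enum -enumT size_enum_ord. Qed.

Lemma monic_rising_poly k : rising_poly k \is monic.
Proof. exact: monic_prod_XsubC. Qed.

Lemma rising_poly_ffact k n : (rising_poly k).[n.+1%:R] = ((n + k) ^_ k)%:R.
Proof.
elim: k => [|k IH]; first by rewrite /rising_poly big_ord0 hornerC.
have -> : rising_poly k.+1 = rising_poly k * ('X - (- k%:R)%:P).
  by rewrite /rising_poly big_ord_recr.
rewrite hornerM IH hornerXsubC opprK -natrD addnS ffactSS mulnC natrM.
by rewrite addSn.
Qed.

End PolynomialGrowth.

Section Multiplicity.
Import Order.TTheory Num.Theory.
Variables (R : comNzRingType) (m : set R).
Hypothesis noethR : noetherian R.
Hypothesis localR : local_ring m.
Variables (dim : nat) (c : set R).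
Hypothesis regc : regular_ideal dim c.
Hypothesis openc : open_ideal m c.
Hypothesis properc : ~ c 1.

Let hc : is_ideal c. Proof. by case: openc. Qed.

Definition regular_hilbert_poly : {poly rat} :=
  ((colength c)%:R / dim`!%:R) *: rising_poly dim.

Lemma regular_hilbert_polyE n : (0 < n)%N ->
  (colength (ideal_exp c n))%:R = regular_hilbert_poly.[n%:R].
Proof.
case: n => [//|n] _.
rewrite (colength_regular_exp noethR localR regc openc) hornerZ rising_poly_ffact.
rewrite -bin_sub ?leq_addr // addKn -bin_ffact !natrM.
have : dim`!%:R != 0 :> rat by rewrite pnatr_eq0 -lt0n fact_gt0.
by move=> h; field.
Qed.

Lemma coef_regular_hilbert_poly :
  regular_hilbert_poly`_dim = (colength c)%:R / dim`!%:R.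
Proof.
have /monicP := monic_rising_poly dim.
by rewrite lead_coefE size_rising_poly coefZ => ->; rewrite mulr1.
Qed.

Lemma size_regular_hilbert_poly_diff k :
  (size (regular_hilbert_poly - (regular_hilbert_poly \Po ('X - (k%:R)%:P)))%R <= dim)%N.
Proof.
rewrite /regular_hilbert_poly comp_polyZ -scalerBr.
apply: leq_trans (size_scale_leq _ _) _; set q := rising_poly dim.
have s1 : size q = dim.+1 := size_rising_poly dim.
have s2 : size (q \Po ('X - (k%:R)%:P)) = dim.+1.
  by rewrite size_comp_poly2 // size_XsubC.
have l1 : q`_dim = 1 by have /monicP := monic_rising_poly dim; rewrite lead_coefE s1.
have l2 : (q \Po ('X - (k%:R)%:P))`_dim = 1.
  have : lead_coef (q \Po ('X - (k%:R)%:P)) = 1.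
    rewrite lead_coef_comp ?size_XsubC // lead_coefXsubC expr1n mulr1.
    exact/monicP/monic_rising_poly.
  by rewrite lead_coefE s2.
apply/leq_sizeP => j; rewrite leq_eqVlt => /orP[/eqP <-|hj].
  by rewrite coefB l1 l2 subrr.
by rewrite coefB !nth_default ?subrr ?s1 ?s2.
Qed.

(** From [a^(k+1) = c a^k] one gets [a^(n+k) = c^n a^k]. *)
Lemma reduction_exp a : reduction c a ->
  exists k, forall n, ideal_exp a (n + k) `<=` ideal_exp c n.
Proof.
move=> [_ _ [k hk]]; exists k => n.
have step j : ideal_exp a (j + k).+1 `<=` ideal_mul c (ideal_exp a (j + k)).
  elim: j => [|j IH]; first by rewrite add0n hk.
  rewrite addSn ideal_expS (ideal_expS a (j + k)).
  apply: subset_trans (ideal_mul_mono (@subset_refl _ a) IH) _.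
  rewrite ideal_mulC (ideal_mulC a); exact: ideal_mulA_sub.
elim: n => [//|n IH]; rewrite addSn.
by apply: subset_trans (step n) _; exact: ideal_mul_mono.
Qed.

(** The multiplicity of [c] is its colength, and the Hilbert polynomials of
    [c] and of an ideal having [c] as a reduction differ by a polynomial of
    smaller degree. *)
Lemma multiplicity_reduction a : is_ideal a -> reduction c a ->
  multiplicity a = (colength c)%:R.
Proof.
move=> ha red; have [_ ca _] := red; have [k hk] := reduction_exp red.
have oa : open_ideal m a by exact: open_sub openc ha ca.
have [N hp] : is_hilbert_samuel_poly a (hilbert_samuel_poly a).
  exact: xgetPex (hilbert_samuel_exists noethR localR oa).
set p := hilbert_samuel_poly a in hp.
have le_col I J : open_ideal m I -> is_ideal J -> I `<=` J ->
    (colength J)%:R <= (colength I)%:R :> rat.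
  by move=> oI hJ IJ; rewrite ler_nat; exact: (colength_antitone noethR localR).
(* The inclusions [a^n <= c^(n-k)] and [c^n <= a^n] bound the difference by one
   between two values of the same polynomial. *)
have /eqP : (regular_hilbert_poly - p)`_dim = 0.
  apply: (@coef_squeeze _ _ _ (N + k).+1 (size_regular_hilbert_poly_diff k)) => n hn.
  have hpn : (colength (ideal_exp a n))%:R = p.[n%:R] by apply: hp; lia.
  have en : n%:R - k%:R = (n - k)%:R :> rat by rewrite natrB //; lia.
  rewrite !(hornerD, hornerN, horner_comp, hornerX, hornerC) en.
  rewrite -!regular_hilbert_polyE; try by lia.
  rewrite -hpn subr_ge0 lerD2l lerN2; apply/andP; split.
    apply: le_col; [exact: open_exp|exact: is_ideal_exp|exact: ideal_exp_mono].
  apply: le_col; [exact: open_exp|exact: is_ideal_exp|].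
  by have := hk (n - k)%N; rewrite subnK //; lia.
rewrite coefB subr_eq0 coef_regular_hilbert_poly => /eqP e.
rewrite /multiplicity (krull_dim_regular noethR localR regc openc properc) -/p -e.
have : dim`!%:R != 0 :> rat by rewrite pnatr_eq0 -lt0n fact_gt0.
by move=> h; field.
Qed.

End Multiplicity.

(** * The alternating sum *)

Section LinkageChain.
Variables (R : comNzRingType) (m : set R).
Hypothesis gorR : gorenstein_local m.
Implicit Types a b c : set R.

Let noethR : noetherian R. Proof. by case: gorR. Qed.
Let localR : local_ring m. Proof. by case: gorR. Qed.

Lemma m_primary_open a : m_primary m a -> open_ideal m a.
Proof. by move=> [[[ha _] _] hrad]; split => // x; rewrite -hrad. Qed.

Lemma open_reduction c a : reduction c a -> open_ideal m a -> open_ideal m c.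
Proof.
move=> [hc _ [k hk]] oa; apply: (open_sub (open_exp k.+1 oa) hc).
by rewrite hk; exact: ideal_mul_subl.
Qed.

Lemma reduction_refl c : is_ideal c -> reduction c c.
Proof. by move=> hc; split => //; exists 0%N. Qed.

Lemma multiplicity_complete_intersection c :
  complete_intersection c -> open_ideal m c -> multiplicity c = (colength c)%:R.
Proof.
move=> /complete_intersectionP [nc1 [k regc]] oc; have hc : is_ideal c by case: oc.
exact: (multiplicity_reduction noethR localR regc oc nc1 hc (reduction_refl hc)).
Qed.

Lemma multiplicity_link c a b : open_ideal m a -> linked c a b -> reduction c a ->
  open_ideal m b /\ multiplicity a = (colength a + colength b)%:R.
Proof.
move=> oa [ci _ [hb _] eb _] red; have oc := open_reduction red oa.
have ha : is_ideal a by case: oa.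
have [_ ca _] := red; have [nc1 [k regc]] := complete_intersectionP ci.
split.
  apply: (open_sub oc hb); rewrite eb; exact: sub_colon oc _ ha.
rewrite (multiplicity_reduction noethR localR regc oc nc1 ha red) eb.
by rewrite (colength_linked gorR regc oc nc1 ha ca).
Qed.

End LinkageChain.

Theorem theorem2p2 (R : comNzRingType) (m : set R)
  (hR : gorenstein_local m)
  (hk : infinite_set (residue_field m))
  (n : nat) (a : set R)
  (ha : m_primary m a)
  (hlicci : linked_to_ci_in_steps n a)
  (a_ : nat -> set R)
  (ha0 : a_ 0%N = a)
  (hlink : forall i : nat, (i < n)%N ->
     exists c : set R, linked c (a_ i) (a_ i.+1) /\ minimal_reduction c (a_ i))
  (han : complete_intersection (a_ n)) :
  (colength a)%:R = \sum_(0 <= i < n.+1) (-1) ^+ i * multiplicity (a_ i) :> rat.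
Proof.
have link i : (i < n)%N -> open_ideal m (a_ i) ->
    open_ideal m (a_ i.+1) /\
    multiplicity (a_ i) = (colength (a_ i) + colength (a_ i.+1))%:R.
  move=> /hlink [c [lc [red _]]] oi; exact: (multiplicity_link hR oi lc red).
have opena i : (i <= n)%N -> open_ideal m (a_ i).
  elim: i => [_|i IH hi]; first by rewrite ha0; exact: m_primary_open.
  by have [] := link i hi (IH (ltnW hi)).
(* Partial sums, with the colength of [a_ j] as the remainder. *)
have partial j : (j <= n)%N ->
    (colength a)%:R = \sum_(0 <= i < j) (-1) ^+ i * multiplicity (a_ i)
                      + (-1) ^+ j * (colength (a_ j))%:R :> rat.
  elim: j => [_|j IH hj]; first by rewrite big_nil ha0; ring.
  have [_ e] := link j hj (opena j (ltnW hj)).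
  by rewrite (IH (ltnW hj)) big_nat_recr //= e natrD exprS; ring.
rewrite (partial n (leqnn n)) big_nat_recr //=.
by rewrite (multiplicity_complete_intersection hR han (opena n (leqnn n))).
Qed.
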